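(* Let $N_A,N_R,N_B$ be integers with $N_A\ge 1$, $N_R\ge 0$, $N_B\ge 1$, and $N=N_A+N_R+N_B$. Consider a chain of $N$ qubits with Hilbert space $(\mathbb{C}^2)^{\otimes N}$, divided into $A$ (qubits $1,\dots,N_A$), $R$ (the next $N_R$ qubits) and $B$ (the last $N_B$ qubits). Let $H$ be a Hermitian operator on $(\mathbb{C}^2)^{\otimes N}$ of the form $H=\sum_{n=1}^{N}h_n+\sum_{n=1}^{N-1}h_{n,n+1}$, where $h_n$ acts only on qubit $n$ and $h_{n,n+1}$ acts only on qubits $n,n+1$, and suppose $H$ conserves the number of excitations, i.e. $[H,\sum_{n=1}^N Z_n]=0$. Let $|\boldsymbol{0}\rangle=|0\rangle^{\otimes N}$, $|\boldsymbol{n}\rangle=X_n|\boldsymbol{0}\rangle$, and assume there is a time $t_0$ with $f_{1,N}(t_0)\equiv\langle\boldsymbol{N}|e^{-iHt_0}|\boldsymbol{1}\rangle\neq 0$. For $t>0$ and an integer $L\ge 1$, let the memory $M=M_1\otimes\cdots\otimes M_L$ consist of $L$ registers of $N_B$ qubits each, initialised in $|0\rangle_M=|0\rangle^{\otimes N_BL}$. Let $U=e^{-iHt}\otimes 1_M$, let $S_\ell$ be the unitary that swaps the $N_B$ qubits of $B$ with the $N_B$ qubits of $M_\ell$ (qubit by qubit), and set $W=S_LUS_{L-1}U\cdots S_1U$. Then for every $\epsilon>0$ there exist $t>0$, $L\ge 1$ and an isometry $E:(\mathbb{C}^2)^{\otimes N_A}\to\mathcal{H}_M$ such that for every unit vector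 $|\psi\rangle_A\in(\mathbb{C}^2)^{\otimes N_A}$, $$\langle\psi|_A\,E^{\dagger}\,\rho_M\,E\,|\psi\rangle_A\ \ge\ 1-\epsilon,\qquad \rho_M=\mathrm{Tr}_{\text{chain}}\Big[W\big(|\Psi\rangle\langle\Psi|\otimes|0\rangle_M\langle0|\big)W^{\dagger}\Big],$$ where $|\Psi\rangle=|\psi\rangle_A\otimes|0\rangle^{\otimes(N_R+N_B)}$ and $\mathrm{Tr}_{\text{chain}}$ is the partial trace over the $N$ chain qubits.
   Context: $X_n,Z_n$ denote the Pauli $X$ and $Z$ matrices acting on qubit $n$; $|0\rangle,|1\rangle$ is the computational basis of a qubit (with $Z|0\rangle=|0\rangle$). An ''excitation'' is a qubit in state $|1\rangle$. *)

(* Defs.v *)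
From HB Require Import structures.
From mathcomp Require Import all_boot all_order all_algebra.
From mathcomp Require Import complex.
From mathcomp Require Import boolp classical_sets filter reals topology normedtype.
Unset Printing Implicit Defensive.
Import Order.TTheory GRing.Theory Num.Theory.
Import numFieldNormedType.Exports.
Local Open Scope ring_scope.
Local Open Scope complex_scope.

(* basis configurations of n qubits: bit k (0-based) is qubit k+1;
   false = |0>, true = |1> *)
Definition qb (n : nat) : finType := (n.-tuple bool : finType).

Definition idx {T : finType} (x : T) : 'I_#|T| := enum_rank x.

Definition mxof {C : Type} {T : finType} (f : T -> T -> C) : 'M[C]_#|T| :=
  \matrix_(i, j) f (enum_val i) (enum_val j).

Definition ket {C : pzRingType} {T : finType} (x : T) : 'cV[C]_#|T| :=
  delta_mx (idx x) 0.

Definition adj {R : rcfType} {m n} (A : 'M[R[i]]_(m, n)) : 'M[R[i]]_(n, m) :=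
  (map_mx (@conjc R) A)^T.

Definition is_isometry {R : rcfType} {m n} (E : 'M[R[i]]_(m, n)) : Prop :=
  adj E *m E = 1%:M.

Definition is_hermitian {R : rcfType} {n} (A : 'M[R[i]]_n) : Prop := adj A = A.

(* matrix power (works for any size) *)
Definition mxpow {C : pzRingType} {n} (A : 'M[C]_n) (k : nat) : 'M[C]_n :=
  iter k (mulmx A) 1%:M.

Definition expm {R : realType} {n} (A : 'M[R[i]]_n) : 'M[R[i]]_n :=
  \matrix_(i, j)
    let S m := (\sum_(k < m) (k`!%:R)^-1 *: mxpow A k) i j in
    (limn (fun m => complex.Re (S m))) +i* (limn (fun m => complex.Im (S m))).

Definition Xmat {C : pzRingType} : 'M[C]_#|{: bool}| :=
  mxof (fun a b : bool => (a != b)%:R).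
Definition Zmat {C : pzRingType} : 'M[C]_#|{: bool}| :=
  mxof (fun a b : bool => (a == b)%:R * (if a then -1 else 1)).

Definition embed1 {C : pzRingType} (N n : nat) (h : 'M[C]_#|{: bool}|)
  : 'M[C]_#|qb N| :=
  mxof (fun x y : qb N =>
    h (idx (nth false x n)) (idx (nth false y n)) *
    [forall k : 'I_N, (val k != n) ==> (nth false x k == nth false y k)]%:R).

Definition embed2 {C : pzRingType} (N n : nat) (h : 'M[C]_#|{: bool * bool}|)
  : 'M[C]_#|qb N| :=
  mxof (fun x y : qb N =>
    h (idx (nth false x n, nth false x n.+1))
      (idx (nth false y n, nth false y n.+1)) *
    [forall k : 'I_N, ((val k != n) && (val k != n.+1)) ==>
                        (nth false x k == nth false y k)]%:R).

Definition Xop {C : pzRingType} (N n : nat) : 'M[C]_#|qb N| := embed1 N n Xmat.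
Definition Zop {C : pzRingType} (N n : nat) : 'M[C]_#|qb N| := embed1 N n Zmat.

Definition nn_hamiltonian {C : pzRingType} {N : nat} (H : 'M[C]_#|qb N|) : Prop :=
  exists (h1 : nat -> 'M[C]_#|{: bool}|) (h2 : nat -> 'M[C]_#|{: bool * bool}|),
    H = \sum_(n < N) embed1 N n (h1 n) + \sum_(n < N.-1) embed2 N n (h2 n).

Definition conserves_excitations {C : pzRingType} {N : nat} (H : 'M[C]_#|qb N|)
  : Prop :=
  H *m (\sum_(n < N) Zop N n) = (\sum_(n < N) Zop N n) *m H.

Definition ket0 {C : pzRingType} (N : nat) : 'cV[C]_#|qb N| :=
  ket [tuple false | _ < N].
Definition ketn {C : pzRingType} (N n : nat) : 'cV[C]_#|qb N| :=
  Xop N n *m ket0 N.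

Definition propagator {R : realType} {n} (H : 'M[R[i]]_n) (t : R) : 'M[R[i]]_n :=
  expm (- ('i * t%:C) *: H).

Definition f1N {R : realType} {N : nat} (H : 'M[R[i]]_#|qb N|) (t : R) : R[i] :=
  (adj (ketn N N.-1) *m propagator H t *m ketn N 0) ord0 ord0.

Definition memT (NB L : nat) : finType := ({ffun 'I_L -> qb NB} : finType).
Definition sysT (NA NR NB L : nat) : finType := ((qb (NA + NR + NB) * memT NB L)%type : finType).

Definition Uop {R : realType} (NA NR NB L : nat)
  (H : 'M[R[i]]_#|qb (NA + NR + NB)|) (t : R) : 'M[R[i]]_#|sysT NA NR NB L| :=
  mxof (fun x y : sysT NA NR NB L =>
    propagator H t (idx x.1) (idx y.1) * (x.2 == y.2)%:R).

Definition swapcfg {NA NR NB L : nat} (l : 'I_L) (x : sysT NA NR NB L)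
  : sysT NA NR NB L :=
  ([tuple (if (NA + NR <= k)%N then nth false (x.2 l) (k - (NA + NR))
           else nth false x.1 k) | k < NA + NR + NB],
   [ffun l' => if l' == l then [tuple nth false x.1 (NA + NR + j) | j < NB]
               else x.2 l']).

Definition Sop {C : pzRingType} (NA NR NB L : nat) (l : 'I_L)
  : 'M[C]_#|sysT NA NR NB L| :=
  mxof (fun x y : sysT NA NR NB L => (x == swapcfg l y)%:R).

Definition Wop {R : realType} (NA NR NB L : nat)
  (H : 'M[R[i]]_#|qb (NA + NR + NB)|) (t : R) : 'M[R[i]]_#|sysT NA NR NB L| :=
  foldl (fun W l => Sop NA NR NB L l *m Uop NA NR NB L H t *m W) 1%:M (enum 'I_L).

Definition init_state {R : realType} (NA NR NB L : nat)
  (psi : 'cV[R[i]]_#|qb NA|) : 'cV[R[i]]_#|sysT NA NR NB L| :=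
  \col_i let x : sysT NA NR NB L := enum_val i in
    psi (idx [tuple nth false x.1 k | k < NA]) 0 *
    ([forall k : 'I_(NA + NR + NB), (NA <= k)%N ==> ~~ nth false x.1 k] &&
     (x.2 == [ffun _ => [tuple false | _ < NB]]))%:R.

Definition ptrace_chain {C : nzRingType} (NA NR NB L : nat)
  (rho : 'M[C]_#|sysT NA NR NB L|) : 'M[C]_#|memT NB L| :=
  mxof (fun m m' : memT NB L =>
    \sum_(c : qb (NA + NR + NB)) rho (idx ((c, m) : sysT NA NR NB L))
                                     (idx ((c, m') : sysT NA NR NB L))).

Definition rhoM {R : realType} (NA NR NB L : nat)
  (H : 'M[R[i]]_#|qb (NA + NR + NB)|) (t : R) (psi : 'cV[R[i]]_#|qb NA|)
  : 'M[R[i]]_#|memT NB L| :=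
  let W := Wop NA NR NB L H t in
  let Psi := init_state NA NR NB L psi in
  ptrace_chain NA NR NB L (W *m (Psi *m adj Psi) *m adj W).

(* Main.v *)
Require Import Defs.
From HB Require Import structures.
From mathcomp Require Import all_boot all_order all_algebra.
From mathcomp Require Import complex.
From mathcomp Require Import boolp classical_sets filter reals topology normedtype.
From mathcomp Require Import sequences trigo.
From mathcomp Require Import ring lra zify.
Import Order.TTheory GRing.Theory Num.Theory.
Import numFieldNormedType.Exports.
Local Open Scope ring_scope.
Local Open Scope complex_scope.

(* Since H conserves excitations, each swap can only remove excitations from the chain, and one
   step decreases the mean excitation number by the mean number absorbed. A state that never
   loses anything to B is trivial: for a suitable t all H^r u are polynomials in U = e^(-iHt)
   applied to u, so they have no excitation in B; since f_{1,N} <> 0 every nearest-neighbour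
   hopping amplitude is nonzero, and pulling the excitations back site by site shows that u is
   a multiple of the vacuum. In finite dimension this gives a uniform contraction of the
   excitation number over dim steps, so the chain ends up arbitrarily close to the vacuum.
   The vacuum amplitude then defines F : A -> M with F^dag F >= 1 - eta, and E is the isometry
   in the polar decomposition of F. *)

(** * Adjoints, squared norms and operator bounds *)

Lemma adjE {R : rcfType} {m n} (A : 'M[R[i]]_(m, n)) i j :
  adj A i j = conjc (A j i).
Proof. by rewrite /adj !mxE. Qed.

Lemma adjK {R : rcfType} {m n} (A : 'M[R[i]]_(m, n)) : adj (adj A) = A.
Proof. by apply/matrixP => i j; rewrite !adjE conjcK. Qed.

Lemma adjM {R : rcfType} {m n p} (A : 'M[R[i]]_(m, n)) (B : 'M[R[i]]_(n, p)) :
  adj (A *m B) = adj B *m adj A.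
Proof. by rewrite /adj map_mxM trmx_mul. Qed.

(** The squared modulus is valued in [R], so that estimates live in a totally ordered field rather
    than in the partial order of [R[i]]. *)
Definition sqn {R : rcfType} (z : R[i]) : R := complex.Re z ^+ 2 + complex.Im z ^+ 2.

Definition sqnv {R : rcfType} {n} (v : 'cV[R[i]]_n) : R := \sum_i sqn (v i 0).

Lemma sqnE {R : rcfType} (z : R[i]) : (sqn z)%:C = conjc z * z.
Proof. by case: z => a b; rewrite /sqn /=; simpc; congr (_ +i* _); ring. Qed.

Lemma sqn_ge0 {R : rcfType} (z : R[i]) : 0 <= sqn z.
Proof. by rewrite addr_ge0 ?sqr_ge0. Qed.

Lemma sqn_eq0 {R : rcfType} (z : R[i]) : sqn z = 0 -> z = 0.
Proof.
case: z => a b /eqP; rewrite /sqn /= paddr_eq0 ?sqr_ge0 // !sqrf_eq0.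
by case/andP => /eqP -> /eqP ->.
Qed.

Lemma sqnM {R : rcfType} (x y : R[i]) : sqn (x * y) = sqn x * sqn y.
Proof. by case: x y => a b [c d]; rewrite /sqn /=; ring. Qed.

Lemma sqn0 {R : rcfType} : sqn (0 : R[i]) = 0.
Proof. by rewrite /sqn /= expr0n addr0. Qed.

Lemma sqn_real {R : rcfType} (a : R) : sqn a%:C = a ^+ 2.
Proof. by rewrite /sqn /= expr0n addr0. Qed.

Lemma sqnD_le {R : rcfType} (x y : R[i]) : sqn (x + y) <= 2 * (sqn x + sqn y).
Proof.
case: x y => a b [c d]; rewrite /sqn /=.
have := sqr_ge0 (a - c); have := sqr_ge0 (b - d); nra.
Qed.

Lemma sqnv_ge0 {R : rcfType} {n} (v : 'cV[R[i]]_n) : 0 <= sqnv v.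
Proof. by apply: sumr_ge0 => i _; apply: sqn_ge0. Qed.

Lemma sqnvE {R : rcfType} {n} (v : 'cV[R[i]]_n) : (adj v *m v) 0 0 = (sqnv v)%:C.
Proof.
by rewrite mxE /sqnv rmorph_sum /=; apply: eq_bigr => i _; rewrite adjE sqnE.
Qed.

Lemma sqnv_isometry {R : rcfType} {m n} (A : 'M[R[i]]_(m, n)) (v : 'cV[R[i]]_n) :
  adj A *m A = 1%:M -> sqnv (A *m v) = sqnv v.
Proof.
move=> hA; apply: (@complexI R); rewrite -!sqnvE adjM.
by rewrite -mulmxA (mulmxA (adj A)) hA mul1mx.
Qed.

(** Iterating [sqnD_le] doubles the constant at each term; the value is crude, but only its
    finiteness is used later. *)
Lemma sqn_sum_le {R : rcfType} {I : Type} (s : seq I) (F : I -> R[i]) :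
  sqn (\sum_(i <- s) F i) <= 2 ^+ size s * \sum_(i <- s) sqn (F i).
Proof.
elim: s => [|a s IH]; first by rewrite !big_nil sqn0 mulr0.
rewrite !big_cons /= exprS -mulrA.
apply: le_trans (sqnD_le _ _) _; rewrite ler_pM2l ?ltr0n // mulrDr lerD //.
by rewrite ler_peMl ?sqn_ge0 // exprn_ege1 // ler1n.
Qed.

Lemma sqnv_mul_bound {R : rcfType} {m n} (M : 'M[R[i]]_(m, n)) :
  exists2 c : R, 0 < c & forall v, sqnv (M *m v) <= c * sqnv v.
Proof.
pose K := \sum_i \sum_j sqn (M i j); have K0 : 0 <= K.
  by apply: sumr_ge0 => i _; apply: sumr_ge0 => j _; apply: sqn_ge0.
exists (2 ^+ n * K + 1) => [|v].
  by rewrite ltr_wpDl // mulr_ge0 // exprn_ge0.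
rewrite mulrDl mul1r; apply: ler_wpDr; first exact: sqnv_ge0.
rewrite /K -mulrA mulr_suml mulr_sumr; apply: ler_sum => i _.
rewrite mxE; apply: le_trans (sqn_sum_le _ _) _.
have -> : size (index_enum 'I_n) = n by rewrite -[RHS]card_ord cardT enumT.
rewrite ler_wpM2l ?exprn_ge0 //.
rewrite mulr_suml; apply: ler_sum => j _; rewrite sqnM ler_wpM2l ?sqn_ge0 //.
rewrite /sqnv (bigD1 j) //= lerDl; apply: sumr_ge0 => k _; exact: sqn_ge0.
Qed.

(** The columns of [cokermx A] lie in the kernel of [A], hence in that of [B], so [B = M A] for some
    [M]; boundedness of [M] gives [d]. This takes the place of a compactness argument on the unit
    sphere. *)
Lemma ker_sub_bound {R : rcfType} {m p n} (A : 'M[R[i]]_(m, n)) (B : 'M[R[i]]_(p, n)) :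
  (forall v : 'cV_n, A *m v = 0 -> B *m v = 0) ->
  exists2 d : R, 0 < d & forall v, d * sqnv (B *m v) <= sqnv (A *m v).
Proof.
move=> h; have /submxP [M BM] : (B <= A)%MS.
  rewrite submxE; apply/eqP/matrixP => i j.
  have /matrixP /(_ i 0) : B *m col j (cokermx A) = 0.
    by apply: h; rewrite colE mulmxA mulmx_coker mul0mx.
  by rewrite colE mulmxA -colE [X in X = _]mxE => ->; rewrite !mxE.
have [c c0 hc] := sqnv_mul_bound M; exists c^-1; first by rewrite invr_gt0.
by move=> v; rewrite BM -mulmxA mulrC ler_pdivrMr // mulrC.
Qed.

(** * Spectral theorem, functional calculus and polar decomposition *)

Lemma spectral_decomposition {C : numClosedFieldType} {n} (A : 'M[C]_n) :
  map_mx Num.conj A^T = A -> exists (V : 'M[C]_n) (d : 'rV_n),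
    [/\ V *m map_mx Num.conj V^T = 1%:M, A = map_mx Num.conj V^T *m diag_mx d *m V
      & forall j, d 0 j \is Num.real].
Proof.
move=> hA; have herm : A \is hermsymmx.
  by apply/is_hermitianmxP; rewrite expr0 scale1r hA.
have unit := spectral_unitarymx A.
exists (spectralmx A), (spectral_diag A); split.
- exact/unitarymxP.
- by rewrite -invmx_unitary //; apply/orthomx_spectralP/hermitian_normalmx.
- by have /mxOverP h := hermitian_spectral_diag_real herm.
Qed.

Lemma hermitian_diag {R : rcfType} {n} (A : 'M[R[i]]_n) : is_hermitian A ->
  exists (V : 'M[R[i]]_n) (l : 'I_n -> R),
    [/\ adj V *m V = 1%:M, V *m adj V = 1%:M
      & A = adj V *m diag_mx (\row_i (l i)%:C) *m V].
Proof.
have adjtC (B : 'M[R[i]]_n) : map_mx Num.conj B^T = adj B.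
  by apply/matrixP => i j; rewrite mxE mxE adjE.
rewrite /is_hermitian -adjtC => /spectral_decomposition [V [d [VV AE dR]]].
rewrite adjtC in VV AE.
exists V, (fun i => complex.Re (d 0 i)); split; [exact: mulmx1C VV|exact: VV|].
rewrite [LHS]AE; congr (_ *m diag_mx _ *m _); apply/matrixP => i j; rewrite mxE ord1.
exact/esym/RRe_real/dR.
Qed.

(** Functional calculus: if [V] diagonalises a Hermitian matrix and [f] is a function of its
    eigenvalues, this is that function of the matrix. *)
Definition sdiag {R : rcfType} {n} (V : 'M[R[i]]_n) (f : 'I_n -> R[i]) : 'M[R[i]]_n :=
  adj V *m diag_mx (\row_i f i) *m V.

Lemma eq_sdiag {R : rcfType} {n} (V : 'M[R[i]]_n) f g : f =1 g -> sdiag V f = sdiag V g.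
Proof. by move=> h; congr (_ *m diag_mx _ *m _); apply/rowP => i; rewrite !mxE. Qed.

Lemma sdiagE {R : rcfType} {n} (V : 'M[R[i]]_n) f i j :
  sdiag V f i j = \sum_k conjc (V k i) * V k j * f k.
Proof.
rewrite /sdiag -mulmxA mxE; apply: eq_bigr => k _.
by rewrite mul_diag_mx !mxE mulrCA mulrC.
Qed.

Lemma sdiag_quad {R : rcfType} {n} (V : 'M[R[i]]_n) f (v : 'cV_n) :
  (adj v *m sdiag V f *m v) 0 0 = \sum_k f k * (sqn ((V *m v) k 0))%:C.
Proof.
rewrite /sdiag !mulmxA -adjM -2!mulmxA mxE; apply: eq_bigr => k _.
by rewrite adjE mul_diag_mx !mxE sqnE mulrCA.
Qed.

Lemma sdiag_adj {R : rcfType} {n} (V : 'M[R[i]]_n) f :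
  adj (sdiag V f) = sdiag V (fun k => conjc (f k)).
Proof.
rewrite /sdiag !adjM adjK mulmxA; congr (_ *m _ *m _).
by apply/matrixP => i j; rewrite adjE !mxE eq_sym rmorphMn /=; case: eqP => [->|].
Qed.

Lemma sdiag_sumZ {R : rcfType} {n} (V : 'M[R[i]]_n) (I : finType) (c : I -> R[i])
    (f : I -> 'I_n -> R[i]) :
  sdiag V (fun k => \sum_i c i * f i k) = \sum_i c i *: sdiag V (f i).
Proof.
apply/matrixP => i j; rewrite sdiagE summxE.
under [RHS]eq_bigr do rewrite mxE sdiagE mulr_sumr.
rewrite exchange_big /=; apply: eq_bigr => k _; rewrite mulr_sumr.
by apply: eq_bigr => r _; rewrite mulrCA.
Qed.

Lemma sdiagM {R : rcfType} {n} (V : 'M[R[i]]_n) f g : V *m adj V = 1%:M ->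
  sdiag V f *m sdiag V g = sdiag V (fun k => f k * g k).
Proof.
move=> h; rewrite /sdiag !mulmxA -[_ *m V *m adj V]mulmxA h mulmx1.
rewrite -[adj V *m _ *m diag_mx _]mulmxA; congr (_ *m _ *m _).
by rewrite mulmx_diag; congr diag_mx; apply/rowP => k; rewrite !mxE.
Qed.

Lemma sdiag1 {R : rcfType} {n} (V : 'M[R[i]]_n) : adj V *m V = 1%:M ->
  sdiag V (fun=> 1) = 1%:M.
Proof.
move=> h; rewrite /sdiag (_ : diag_mx _ = 1%:M) ?mulmx1 //.
by apply/matrixP => i j; rewrite !mxE.
Qed.

Lemma sdiagX {R : rcfType} {n} (V : 'M[R[i]]_n) f k :
  adj V *m V = 1%:M -> V *m adj V = 1%:M ->
  mxpow (sdiag V f) k = sdiag V (fun i => f i ^+ k).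
Proof.
move=> h1 h2; elim: k => [|k IH]; first by rewrite sdiag1.
by rewrite -[LHS]/(_ *m mxpow _ k) IH (sdiagM _ _ _ h2); apply: eq_sdiag => i; rewrite exprS.
Qed.

(* [E = F (F^dag F)^(-1/2)] *)
Lemma polar_isometry {R : rcfType} {m n} (F : 'M[R[i]]_(m, n)) (s : R) : 0 < s ->
  (forall v, s ^+ 2 * sqnv v <= sqnv (F *m v)) ->
  exists2 E : 'M[R[i]]_(m, n), is_isometry E &
    forall v, exists2 r : R, s * sqnv v <= r & (adj v *m (adj E *m F) *m v) 0 0 = r%:C.
Proof.
move=> s0 hF; have [|V [l [VV VV' G]]] := @hermitian_diag R n (adj F *m F).
  by rewrite /is_hermitian adjM adjK.
rewrite -/(sdiag V (fun i => (l i)%:C)) in G.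
have quad v : sqnv (F *m v) = \sum_k l k * sqn ((V *m v) k 0).
  apply: (@complexI R); rewrite -sqnvE adjM mulmxA -[adj v *m _ *m _]mulmxA G sdiag_quad.
  by rewrite rmorph_sum; apply: eq_bigr => k _; rewrite rmorphM.
have nV v : sqnv v = \sum_k sqn ((V *m v) k 0) by rewrite -[RHS]/(sqnv _) sqnv_isometry.
(* Testing the lower bound on the eigenvector [V^dag e_k] of [F^dag F] bounds each eigenvalue below,
   so that the inverse square root exists. *)
have ls k : s ^+ 2 <= l k.
  have := hF (adj V *m delta_mx k 0); rewrite quad nV mulmxA VV' mul1mx.
  have one (g : 'I_n -> R) : \sum_j g j * sqn ((delta_mx k 0 : 'cV[R[i]]_n) j 0) = g k.
    rewrite (bigD1 k) //= big1 => [|j /negbTE nj].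
      by rewrite mxE !eqxx sqn_real expr1n mulr1 addr0.
    by rewrite mxE nj sqn0 mulr0.
  rewrite one; under [X in _ * X]eq_bigr do rewrite -[sqn _]mul1r.
  by rewrite one mulr1.
have l0 k : 0 < l k by apply: lt_le_trans (ls k); rewrite exprn_gt0.
pose q k := Num.sqrt (l k).
have q0 k : q k != 0 by rewrite gt_eqF // sqrtr_gt0.
have qq k : q k * q k = l k by rewrite -expr2 sqr_sqrtr // ltW.
exists (F *m sdiag V (fun k => ((q k)^-1)%:C)) => [|v].
  rewrite /is_isometry adjM sdiag_adj mulmxA -[_ *m adj F *m F]mulmxA G !sdiagM //.
  rewrite -(sdiag1 V VV); apply: eq_sdiag => k.
  by rewrite conjc_real -!rmorphM /= -qq mulrA mulVf // mul1r mulfV.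
exists (\sum_k q k * sqn ((V *m v) k 0)).
  rewrite nV mulr_sumr; apply: ler_sum => k _; rewrite ler_wpM2r ?sqn_ge0 //.
  by rewrite -[s]gtr0_norm // -sqrtr_sqr ler_wsqrtr.
(* [E^dag F] is the positive square root of [F^dag F], whose eigenvalues [q k] are at least [s]. *)
rewrite adjM sdiag_adj -[_ *m adj F *m F]mulmxA G sdiagM // sdiag_quad rmorph_sum.
apply: eq_bigr => k _; rewrite [RHS]rmorphM; congr (_ * _).
by rewrite conjc_real -rmorphM /= -qq mulrA mulVf // mul1r.
Qed.

(** * The propagator in an eigenbasis *)

Definition cis {R : realType} (x : R) : R[i] := cos x -i* sin x.

(** Even powers of [-ix] are real and give the cosine series; odd powers are imaginary and give
    minus the sine series. *)
Lemma cis_coeff {R : realType} (x : R) (k : nat) :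
  (k`!%:R)^-1 * (- ('i * x%:C)) ^+ k = cos_coeff x k -i* sin_coeff x k.
Proof.
have sq : (- ('i * x%:C)) ^+ 2 = (- (x ^+ 2))%:C :> R[i].
  by rewrite sqrrN expr2; simpc; congr (_ +i* _); ring.
have fk : (k`!%:R)^-1 = ((k`!%:R)^-1)%:C :> R[i] by rewrite rmorphV ?unitfE ?pnatr_eq0 -?lt0n ?fact_gt0 //= rmorph_nat.
have ev m : (- ('i * x%:C)) ^+ m.*2 = ((-1) ^+ m * x ^+ m.*2)%:C :> R[i].
  by rewrite -mul2n [LHS]exprM sq -rmorphXn [x ^+ (2 * m)%N]exprM -exprNn.
have -> : (- ('i * x%:C)) ^+ k =
    (- ('i * x%:C)) ^+ odd k * ((-1) ^+ k./2 * x ^+ k./2.*2)%:C :> R[i].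
  by rewrite -ev -exprD odd_double_half.
have xk : x ^+ k = x ^+ odd k * x ^+ k./2.*2 by rewrite -exprD odd_double_half.
have pk : odd k -> k.-1./2 = k./2.
  by move=> ok; rewrite -{1}[k]odd_double_half ok add1n /= doubleK.
rewrite fk /cos_coeff /sin_coeff /= xk -exprnP; case: (odd k) pk => [->//|_] /=.
  by rewrite !expr1; simpc; congr (_ +i* _); ring.
by rewrite !expr0; simpc; congr (_ +i* _); ring.
Qed.

Lemma norm_cis {R : realType} (x : R) : conjc (cis x) * cis x = 1.
Proof. by rewrite -sqnE /sqn /= sqrrN cos2Dsin2. Qed.

(** Since 1 is below pi/2, both arguments lie where the sine is injective. *)
Lemma cis_inj {R : realType} (x y : R) : `|x| <= 1 -> `|y| <= 1 -> cis x = cis y -> x = y.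
Proof.
move=> hx hy [_ /oppr_inj]; have := pi_ge2 R; move: hx hy; rewrite !ler_norml.
move=> /andP [? ?] /andP [? ?] ?; apply: sin_inj; rewrite in_itv /=; apply/andP; split; lra.
Qed.

(** Transfers selection rules from the powers of a matrix to its exponential. *)
Lemma expm_entry0 {R : realType} {n} (A : 'M[R[i]]_n) i j :
  (forall k, mxpow A k i j = 0) -> expm A i j = 0.
Proof.
move=> h; rewrite mxE.
have z m : (\sum_(k < m) (k`!%:R)^-1 *: mxpow A k) i j = 0.
  by rewrite summxE big1 // => k _; rewrite mxE h mulr0.
have lim0 (f g : nat -> R) : f =1 (fun=> 0) -> g =1 (fun=> 0) -> limn f +i* limn g = 0 :> R[i].
  by move=> /funext -> /funext ->; rewrite lim_cst.
by apply: lim0 => m; rewrite /= z.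
Qed.

(** Each entry of a partial sum is a finite combination of cosine and sine partial sums, so the
    separate real and imaginary limits in [expm] can be computed termwise. *)
Lemma propagator_sdiag {R : realType} {n} (V : 'M[R[i]]_n) (l : 'I_n -> R) (t : R) :
  adj V *m V = 1%:M -> V *m adj V = 1%:M ->
  propagator (sdiag V (fun k => (l k)%:C)) t = sdiag V (fun k => cis (t * l k)).
Proof.
move=> h1 h2; rewrite /propagator.
have -> : - ('i * t%:C) *: sdiag V (fun k => (l k)%:C) =
          sdiag V (fun k => - ('i * (t * l k)%:C)).
  apply/matrixP => i j; rewrite mxE !sdiagE mulr_sumr; apply: eq_bigr => k _.
  by rewrite rmorphM /=; ring.
apply/matrixP => i j; rewrite mxE.
pose a k := conjc (V k i) * V k j.
have S m : (\sum_(k < m) (k`!%:R)^-1 *: mxpow (sdiag V (fun k => - ('i * (t * l k)%:C))) k) i j =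
  (\sum_k (complex.Re (a k) * series (cos_coeff (t * l k)) m
           + complex.Im (a k) * series (sin_coeff (t * l k)) m)) +i*
  (\sum_k (complex.Im (a k) * series (cos_coeff (t * l k)) m
           - complex.Re (a k) * series (sin_coeff (t * l k)) m)).
  under eq_bigr do rewrite sdiagX //.
  rewrite -(sdiag_sumZ V _ _ (fun (i : 'I_m) k => (- ('i * (t * l k)%:C)) ^+ i)) sdiagE.
  have -> : forall (f g : 'I_n -> R), (\sum_k f k) +i* (\sum_k g k) = \sum_k (f k +i* g k).
    move=> f g; elim/big_ind3: _ => //= x1 x2 x3 y1 y2 y3 <- <-; by simpc.
  apply: eq_bigr => k _; rewrite -/(a k).
  under eq_bigr do rewrite cis_coeff.
  have -> : \sum_(i0 < m) (cos_coeff (t * l k) i0 -i* sin_coeff (t * l k) i0) =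
      series (cos_coeff (t * l k)) m -i* series (sin_coeff (t * l k)) m.
    rewrite !seriesEord /=; elim/big_ind3: _ => //= [|x1 x2 x3 y1 y2 y3 -> ->].
      by rewrite oppr0.
    by simpc.
  by case: (a k) => x y /=; simpc; congr (_ +i* _); ring.
have cc k : (series (cos_coeff (t * l k)) m @[m --> \oo] --> cos (t * l k))%classic.
  by rewrite unlock; apply: is_cvg_series_cos_coeff.
have cs k : (series (sin_coeff (t * l k)) m @[m --> \oo] --> sin (t * l k))%classic.
  by rewrite unlock; apply: is_cvg_series_sin_coeff.
have lims (f f' g g' : nat -> R) x y : f =1 f' -> g =1 g' ->
    (f' m @[m --> \oo] --> x)%classic -> (g' m @[m --> \oo] --> y)%classic -> limn f +i* limn g = x +i* y.
  by move=> /funext -> /funext -> fx gy; congr (_ +i* _); apply: cvg_lim.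
transitivity
  ((\sum_k (complex.Re (a k) * cos (t * l k) + complex.Im (a k) * sin (t * l k))) +i*
   (\sum_k (complex.Im (a k) * cos (t * l k) - complex.Re (a k) * sin (t * l k)))).
  apply: (lims _ _ _ _ _ _ (fun m => congr1 (@complex.Re R) (S m))
                           (fun m => congr1 (@complex.Im R) (S m))) => /=.
    apply: cvg_big => [|k _]; first exact: add_continuous.
    by apply: cvgD; apply: cvgMl_tmp.
  apply: cvg_big => [|k _]; first exact: add_continuous.
  by apply: cvgB; apply: cvgMl_tmp.
rewrite sdiagE.
have -> : forall (f g : 'I_n -> R), (\sum_k f k) +i* (\sum_k g k) = \sum_k (f k +i* g k).
  move=> f g; elim/big_ind3: _ => //= x1 x2 x3 y1 y2 y3 <- <-; by simpc.
apply: eq_bigr => k _; rewrite -/(a k) /cis.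
by case: (a k) => x y /=; simpc; congr (_ +i* _); ring.
Qed.

(** * Interpolation and the choice of the time step *)

(** Newton's scheme: each new node is matched by adding a multiple of the product that vanishes at
    the previous nodes. *)
Lemma interpolation {F : fieldType} (s : seq F) (g : F -> F) : uniq s ->
  exists2 p : {poly F}, (size p <= size s)%N & {in s, forall x, p.[x] = g x}.
Proof.
elim: s => [|a s IH] /=; first by exists 0; rewrite ?size_poly0.
move=> /andP [nas /IH [p szp hp]].
pose q := \prod_(b <- s) ('X - b%:P).
have qa : q.[a] != 0 by rewrite -/(root q a) root_prod_XsubC.
exists (p + ((g a - p.[a]) / q.[a]) *: q).
  rewrite (leq_trans (size_polyD _ _)) // geq_max (leq_trans szp) //=.
  by rewrite (leq_trans (size_scale_leq _ _)) // size_prod_XsubC.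
move=> x; rewrite inE hornerD hornerZ => /orP [/eqP ->|xs].
  by rewrite divfK // addrC subrK.
by have /rootP -> : root q x; rewrite ?root_prod_XsubC // mulr0 addr0 hp.
Qed.

Lemma mxpow_sum_ker {R : rcfType} {n} (A B : 'M[R[i]]_n) (p : {poly R[i]})
    (phi : 'rV_n) (u : 'cV_n) (m : nat) :
  B = \sum_(i < m) p`_i *: mxpow A i ->
  (forall i, (i < m)%N -> phi *m mxpow A i *m u = 0) -> phi *m B *m u = 0.
Proof.
move=> -> h; rewrite mulmx_sumr mulmx_suml big1 // => i _.
by rewrite -scalemxAr -scalemxAl h // scaler0.
Qed.

(* For small [t] the phases of distinct eigenvalues stay distinct, so powers of [H] are
   polynomials of degree less than the dimension in the propagator. *)
Lemma good_time {R : realType} {n} (H : 'M[R[i]]_n) : is_hermitian H ->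
  exists t : R, [/\ 0 < t, adj (propagator H t) *m propagator H t = 1%:M &
    forall (phi : 'rV_n) (u : 'cV_n),
      (forall i, (i < n)%N -> phi *m mxpow (propagator H t) i *m u = 0) ->
      forall r, phi *m mxpow H r *m u = 0].
Proof.
move=> /hermitian_diag [V [l [h1 h2]]]; rewrite -/(sdiag V (fun k => (l k)%:C)) => HE.
have s0 : 0 < 1 + \sum_k `|l k| by rewrite ltr_wpDr // sumr_ge0.
(* This choice makes every [t * l k] at most 1 in absolute value, as [cis_inj] requires. *)
pose t := (1 + \sum_k `|l k|)^-1.
have UE := propagator_sdiag V l t h1 h2; rewrite -HE in UE.
pose a k := cis (t * l k).
have al k k' : a k = a k' -> l k = l k'.
  have tl j : `|t * l j| <= 1.
    rewrite normrM gtr0_norm ?invr_gt0 // mulrC ler_pdivrMr // mul1r.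
    by rewrite (bigD1 j) //= addrCA lerDl addr_ge0 // sumr_ge0.
  by move/cis_inj => /(_ (tl _) (tl _)) /mulfI -> //; rewrite gt_eqF // invr_gt0.
exists t; split; first by rewrite invr_gt0.
  rewrite UE sdiag_adj (sdiagM _ _ _ h2) -(sdiag1 V h1).
  by apply: eq_sdiag => k; apply: norm_cis.
move=> phi u h r.
(* Equal phases come from equal eigenvalues, so the picked index does not matter; the default 0 is
   never taken at a phase [a k]. *)
pose g z := if [pick k | a k == z] is Some k then (l k)%:C ^+ r else 0.
have ga k : g (a k) = (l k)%:C ^+ r.
  by rewrite /g; case: pickP => [j /eqP /al -> //|/(_ k)]; rewrite eqxx.
(* Eigenvalues may be degenerate, hence [undup] to obtain distinct nodes. *)
have [p szp hp] := interpolation (undup [seq a k | k <- enum 'I_n]) g (undup_uniq _).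
apply: (mxpow_sum_ker (propagator H t) _ p _ _ n _ h).
rewrite UE HE sdiagX //; under eq_bigr do rewrite sdiagX //.
rewrite -(sdiag_sumZ V _ _ (fun (i : 'I_n) k => a k ^+ i)).
apply: eq_sdiag => k; rewrite -ga -hp; last by rewrite mem_undup map_f // mem_enum.
rewrite (@horner_coef_wide _ n) //.
by rewrite (leq_trans szp) // (leq_trans (size_undup _)) // size_map size_enum_ord.
Qed.

(** * Matrices indexed by bit configurations *)

Lemma idxK {T : finType} (x : T) : enum_val (idx x) = x.
Proof. exact: enum_rankK. Qed.

Lemma mxofE {C : Type} {T : finType} (f : T -> T -> C) x y :
  mxof f (idx x) (idx y) = f x y.
Proof. by rewrite mxE !idxK. Qed.

Lemma sum_idx {V : nmodType} {T : finType} (F : 'I_#|T| -> V) :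
  \sum_i F i = \sum_x F (idx x).
Proof. by rewrite (reindex (@idx T)) //; apply/onW_bij/enum_rank_bij. Qed.

Lemma idxP {T : finType} (i : 'I_#|T|) : exists x : T, i = idx x.
Proof. by exists (enum_val i); rewrite /idx enum_valK. Qed.

Lemma idx_inj {T : finType} : injective (@idx T).
Proof. exact: enum_rank_inj. Qed.

Lemma ketE {C : pzRingType} {T : finType} (x y : T) :
  (ket x : 'cV[C]_#|T|) (idx y) 0 = (y == x)%:R.
Proof. by rewrite mxE andbT (inj_eq idx_inj). Qed.

Lemma mulmx_ket {C : pzRingType} {T : finType} (A : 'M[C]_#|T|) (x y : T) :
  (A *m ket x) (idx y) 0 = A (idx y) (idx x).
Proof. by rewrite -colE mxE. Qed.

Lemma mxpowZ {C : comPzRingType} {n} (c : C) (A : 'M[C]_n) k :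
  mxpow (c *: A) k = c ^+ k *: mxpow A k.
Proof.
elim: k => [|k IH]; first by rewrite scale1r.
by rewrite -[LHS]/(_ *m mxpow _ k) IH -scalemxAl -scalemxAr scalerA -exprS.
Qed.

Lemma qb_ext {N : nat} (x y : qb N) :
  (forall k, (k < N)%N -> nth false x k = nth false y k) -> x = y.
Proof.
move=> h; apply: val_inj; apply: (@eq_from_nth _ false).
  by rewrite (size_tuple x) (size_tuple y).
by move=> k; rewrite size_tuple; apply: h.
Qed.

Lemma qb_over {N : nat} (x : qb N) k : (N <= k)%N -> nth false x k = false.
Proof. by move=> h; rewrite nth_default // size_tuple. Qed.

(** * Matrix entries of a number-conserving nearest-neighbour Hamiltonian *)

Definition wt {N : nat} (x : qb N) : nat := \sum_(k < N) nth false x k.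

Definition agree_off {N : nat} (j k : nat) (x y : qb N) : Prop :=
  forall m, m != j -> m != k -> nth false x m = nth false y m.

(** The entry [H x y] is the amplitude from [y] to [x], so the excitation moves right, from [j] to
    [j.+1]. *)
Definition hop {N : nat} (j : nat) (x y : qb N) : Prop :=
  [/\ nth false x j = false, nth false x j.+1, nth false y j,
      nth false y j.+1 = false & agree_off j j.+1 x y].

Lemma total_Z {R : rcfType} {N : nat} :
  \sum_(n < N) Zop N n =
  diag_mx (\row_i (N%:R - 2 * (wt (enum_val i : qb N))%:R)) :> 'M[R[i]]_#|qb N|.
Proof.
apply/matrixP => i j; have [x ->] := idxP i; have [y ->] := idxP j.
rewrite summxE !mxE idxK (inj_eq idx_inj).
under eq_bigr do rewrite /Zop mxofE mxofE.
have [->|nxy] := eqVneq x y; last first.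
  rewrite mulr0n big1 // => n _; case: eqP => [en|_]; last by rewrite !mul0r.
  case: forallP => [h|_]; last by rewrite mulr0.
  case/eqP: nxy; apply: qb_ext => k kN; have := h (Ordinal kN) => /=.
  by case: eqP => [->|_] //= /eqP.
rewrite mulr1n /wt natr_sum mulr_sumr -[N in N%:R]card_ord -sumr_const -sumrB.
apply: eq_bigr => n _; rewrite eqxx mul1r.
have -> : [forall k : 'I_N, (val k != n) ==> (nth false y k == nth false y k)].
  by apply/forallP => k; rewrite eqxx implybT.
by case: (nth false y n); rewrite /= ?mulr0 ?subr0 mulr1 //; ring.
Qed.

(** [H] commutes with the diagonal matrix of [total_Z], so it cannot connect configurations with
    different eigenvalues [N - 2 wt]. *)
Lemma conserves_wt {R : rcfType} {N : nat} (H : 'M[R[i]]_#|qb N|) (x y : qb N) :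
  conserves_excitations H -> H (idx x) (idx y) != 0 -> wt x = wt y.
Proof.
move=> hc /negPf h0; apply/eqP; have /matrixP /(_ (idx x) (idx y)) := hc.
rewrite total_Z mul_mx_diag mul_diag_mx !mxE !idxK mulrC => /eqP.
rewrite -subr_eq0 -mulrBl mulf_eq0 h0 orbF subr_eq0 => /eqP.
move=> /addrI /oppr_inj /mulfI; rewrite pnatr_eq0 => /(_ isT) /eqP.
by rewrite eqr_nat eq_sym.
Qed.

(** Some local term must contribute. A one-site term changes [j] alone, possibly the last site; a
    two-site term guarantees that [j.+1] is in the chain. *)
Lemma nn_agree {C : pzRingType} {N : nat} (H : 'M[C]_#|qb N|) (x y : qb N) :
  nn_hamiltonian H -> H (idx x) (idx y) != 0 -> x != y ->
  exists j, agree_off j j.+1 x y /\ (agree_off j j x y \/ (j.+1 < N)%N).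
Proof.
move=> [h1 [h2 ->]] + nxy; rewrite mxE !summxE.
have [h _|noh] := boolP [exists j : 'I_N, [forall k : 'I_N,
    (val k != j) ==> (nth false x k == nth false y k)]].
  case/existsP: h => j /forallP h; exists j.
  have a : agree_off j j x y => [k kj _|]; last by split=> [k kj _|]; [apply: a|left].
  have [kN|kN] := ltnP k N; last by rewrite !qb_over.
  by apply/eqP; have := h (Ordinal kN); rewrite /= kj.
rewrite big1 => [|j _]; last first.
  rewrite mxofE (_ : [forall k : _, _] = false) ?mulr0 //.
  by apply: contraNF noh => h; apply/existsP; exists j.
rewrite add0r => h.
have [j hj] : exists j : 'I_N.-1, embed2 N j (h2 j) (idx x) (idx y) != 0.
  apply/existsP; apply: contraNT h; rewrite negb_exists => /forallP h.
  by rewrite big1 // => j _; apply/eqP; move: (h j); rewrite negbK.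
exists j; split; last by right; have := ltn_ord j; lia.
move=> k kj kj1; have [kN|kN] := ltnP k N; last by rewrite !qb_over.
move: hj; rewrite mxofE; case: forallP => [|]; last by rewrite mulr0 eqxx.
by move=> /(_ (Ordinal kN)); rewrite /= kj kj1 /= => /eqP.
Qed.

Lemma wt_agree {N : nat} (x y : qb N) j : agree_off j j.+1 x y -> wt x = wt y ->
  (nth false x j + nth false x j.+1 = nth false y j + nth false y j.+1)%N.
Proof.
move=> h; rewrite /wt.
have S (z : qb N) : (\sum_(k < N) nth false z k = nth false z j + nth false z j.+1 +
    \sum_(k < N | (val k != j) && (val k != j.+1)) nth false z k)%N.
  have [jN|jN] := ltnP j N; last first.
    rewrite !qb_over ?(leq_trans jN) //; apply: eq_bigl => k.
    by have := ltn_ord k; case: eqP; case: eqP => //=; lia.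
  rewrite (bigD1 (Ordinal jN)) //=; have [j1N|j1N] := ltnP j.+1 N; last first.
    rewrite (qb_over z j.+1) // addn0; congr (_ + _)%N; apply: eq_bigl => k.
    rewrite -val_eqE /=; have := ltn_ord k; case: eqP; case: eqP => //=; lia.
  rewrite (bigD1 (Ordinal j1N)) /=; last by rewrite -val_eqE /= gtn_eqF.
  by rewrite addnA; congr (_ + _)%N; apply: eq_bigl => k; rewrite -!val_eqE.
rewrite !S (eq_bigr (fun k : 'I_N => nth false y k : nat)) => [/addIn //|k /andP [kj kj1]].
by rewrite h.
Qed.

(** Only two neighbouring bits may differ and their sum is conserved, which leaves an exchange of 01
    and 10. *)
Lemma nn_hop {R : rcfType} {N : nat} (H : 'M[R[i]]_#|qb N|) (x y : qb N) :
  nn_hamiltonian H -> conserves_excitations H ->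
  H (idx x) (idx y) != 0 -> x != y ->
  exists2 j, (j.+1 < N)%N & hop j x y \/ hop j y x.
Proof.
move=> hn hc h0 nxy; have [j [a aj]] := nn_agree H x y hn h0 nxy.
have w := wt_agree x y j a (conserves_wt H x y hc h0).
have ne : nth false x j != nth false y j.
  apply: contraNneq nxy => e; rewrite e in w; apply/eqP/qb_ext => k _.
  have [->//|kj] := eqVneq k j; have [->|kj1] := eqVneq k j.+1; last exact: a.
  by move/addnI: w; do 2!case: (nth false _ _).
have j1 : (j.+1 < N)%N.
  case: aj => // aj; have := aj j.+1; rewrite gtn_eqF // => /(_ isT isT) e.
  by move: w ne; rewrite e => /addIn; do 2!case: (nth false _ _).
exists j => //; rewrite /hop.
have a' : agree_off j j.+1 y x by move=> k kj kj1; rewrite a.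
move: w ne; case ex: (nth false x j); case ey: (nth false y j) => //;
case ex1: (nth false x j.+1); case ey1: (nth false y j.+1) => // _ _; [right|left]; by split.
Qed.

(** A hop changes both sites of its link, so every one-site term and every other link term vanishes
    on it. The amplitude thus ignores the other qubits, and single-excitation data control all
    sectors. *)
Lemma hop_entry {C : pzRingType} {N : nat} (H : 'M[C]_#|qb N|) : nn_hamiltonian H ->
  exists g : nat -> C, forall j (x y : qb N), (j.+1 < N)%N -> hop j x y ->
    H (idx x) (idx y) = g j.
Proof.
move=> [h1 [h2 ->]].
exists (fun j => h2 j (idx (false, true)) (idx (true, false))) => j x y jN [x0 x1 y1 y0 a].
rewrite mxE !summxE big1 ?add0r => [|n _].
  have jN1 : (j < N.-1)%N by lia.
  rewrite (bigD1 (Ordinal jN1)) //= big1 ?addr0 => [|n nj].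
    rewrite mxofE x0 x1 y1 y0 (_ : [forall k : _, _]) ?mulr1 //.
    by apply/forallP => k; apply/implyP => /andP [kj kj1]; rewrite a.
  rewrite mxofE; case: forallP => [h|_]; last by rewrite mulr0.
  move: nj; rewrite -val_eqE /= => nj.
  have jN' : (j < N)%N by lia.
  have := h (Ordinal jN'); have := h (Ordinal jN); rewrite /= x0 x1 y1 y0 /= !implybF.
  rewrite !negb_and !negbK => /orP [] /eqP e1 /orP [] /eqP e2; exfalso; move/eqP: nj; lia.
rewrite mxofE; case: forallP => [h|_]; last by rewrite mulr0.
have jN' : (j < N)%N by lia.
have := h (Ordinal jN'); have := h (Ordinal jN); rewrite /= x0 x1 y1 y0 /= !implybF.
by rewrite !negbK => /eqP e1 /eqP e2; exfalso; lia.
Qed.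

Lemma mulmx_idxE {C : pzRingType} {T : finType} {p} (A : 'M[C]_#|T|) (B : 'M[C]_(#|T|, p))
    (x : T) j : (A *m B) (idx x) j = \sum_y A (idx x) (idx y) * B (idx y) j.
Proof. by rewrite mxE sum_idx. Qed.

Lemma mxpowS_mul {C : pzRingType} {n p} (A : 'M[C]_n) (B : 'M[C]_(n, p)) r :
  mxpow A r.+1 *m B = A *m (mxpow A r *m B).
Proof. by rewrite mulmxA. Qed.

(** * Nonzero hopping and propagation of dark states *)

Definition site {N : nat} (n : nat) : qb N := [tuple val k == n | k < N].

Lemma nth_bits {N : nat} (f : nat -> bool) k :
  (k < N)%N -> nth false [tuple f (val i) | i < N] k = f k.
Proof.
move=> h; have := tnth_mktuple (fun i : 'I_N => f (val i)) (Ordinal h).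
by rewrite (tnth_nth false).
Qed.

Lemma nth_vac {N : nat} k : nth false [tuple false | _ < N] k = false.
Proof.
have [h|h] := ltnP k N; first exact: (nth_bits (fun=> false)).
exact: qb_over.
Qed.

Lemma nth_site {N n : nat} k : (k < N)%N -> nth false (site n : qb N) k = (k == n).
Proof. exact: (nth_bits (fun k => k == n)). Qed.

Lemma ketnE {C : pzRingType} {N n : nat} : (n < N)%N ->
  ketn N n = ket (site n) :> 'cV[C]_#|qb N|.
Proof.
move=> nN; apply/matrixP => i j; rewrite ord1; have [x ->] := idxP i.
rewrite ketE mulmx_ket mxofE mxofE nth_vac; have [->|ne] := eqVneq x (site n).
  rewrite nth_site // eqxx mul1r; case: forallP => // [[]] k.
  by apply/implyP => /negbTE kn; rewrite nth_vac nth_site // kn.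
case x0 : (nth false x n); rewrite ?mul0r //.
case: forallP; rewrite ?mulr0 // => h; case/eqP: ne; apply: qb_ext => k kN.
rewrite nth_site //; have := h (Ordinal kN); rewrite /= nth_vac.
by case: eqP => [-> _|_ /eqP].
Qed.

Lemma ket_sandwich {R : rcfType} {T : finType} (A : 'M[R[i]]_#|T|) (x y : T) :
  (adj (ket x) *m A *m ket y) 0 0 = A (idx x) (idx y).
Proof.
rewrite -mulmxA mxE sum_idx (bigD1 x) //= big1 => [|z /negPf zx]; last first.
  by rewrite adjE ketE zx conjc0 mul0r.
by rewrite adjE ketE eqxx conjc1 mul1r addr0 mulmx_ket.
Qed.

(* If hopping across the link [j] vanished, no excitation started at site 0 could cross it. *)
Lemma hopping_neq0 {R : realType} {N : nat} (H : 'M[R[i]]_#|qb N|) (g : nat -> R[i]) t :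
  nn_hamiltonian H -> conserves_excitations H ->
  (forall j (x y : qb N), (j.+1 < N)%N -> hop j x y -> H (idx x) (idx y) = g j) ->
  f1N H t != 0 -> forall j, (j.+1 < N)%N -> g j != 0.
Proof.
move=> hn hc hg + j jN; apply: contraNN => /eqP gj; apply/eqP.
(* If [g j = 0], every power of [H] keeps the excitation that starts at site 0 on sites up to
   [j]. *)
have stay r (x : qb N) : mxpow H r (idx x) (idx (site 0)) != 0 ->
    forall m, (j < m)%N -> nth false x m = false.
  elim: r x => [|r IH] x.
    rewrite mxE (inj_eq idx_inj); have [-> _ m jm|_] := eqVneq x (site 0); last by rewrite eqxx.
    have [mN|mN] := ltnP m N; last by rewrite qb_over.
    by rewrite nth_site // gtn_eqF //; lia.
  rewrite [mxpow _ _]/= -/(mxpow _ _) mulmx_idxE => h.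
  have [y] : exists y : qb N, H (idx x) (idx y) * mxpow H r (idx y) (idx (site 0)) != 0.
    apply/existsP; apply: contraNT h; rewrite negb_exists => /forallP h.
    by rewrite big1 // => y _; apply/eqP; move: (h y); rewrite negbK.
  rewrite mulf_eq0 negb_or => /andP [Hxy /IH hy].
  have [-> //|nxy] := eqVneq x y.
  have [i iN [hxy|hyx]] := nn_hop H x y hn hc Hxy nxy.
    have [_ _ yi _ a] := hxy; have ij : (i <= j)%N.
      by rewrite leqNgt; apply/negP => /hy; rewrite yi.
    have nij : i != j by apply: contraNneq Hxy => ij'; rewrite (hg i) // ij' gj.
    by move=> m jm; rewrite a ?hy //; lia.
  have [_ yi xi _ a] := hyx; have ij : (i.+1 <= j)%N.
    by rewrite leqNgt; apply/negP => /hy; rewrite yi.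
  by move=> m jm; rewrite -a ?hy //; lia.
rewrite /f1N !ketnE ?ket_sandwich; [|lia..].
apply: expm_entry0 => r; rewrite mxpowZ mxE.
have [->|/stay /(_ N.-1)] := eqVneq (mxpow H r (idx (site N.-1)) (idx (site 0))) 0.
  by rewrite mulr0.
by rewrite nth_site ?eqxx => [h|]; [have := h ltac:(lia)|lia].
Qed.

(* Downward induction on the site: an excitation of [H^r u] at its last possible site [m]
   would give [H^(r+1) u] an excitation at [m.+1]. *)
Lemma dark_vacuum {R : rcfType} {N : nat} (H : 'M[R[i]]_#|qb N|) (g : nat -> R[i])
    (u : 'cV[R[i]]_#|qb N|) (n : nat) :
  nn_hamiltonian H -> conserves_excitations H ->
  (forall j (x y : qb N), (j.+1 < N)%N -> hop j x y -> H (idx x) (idx y) = g j) ->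
  (forall j, (j.+1 < N)%N -> g j != 0) -> (n < N)%N ->
  (forall r (x : qb N) k, (n <= k)%N -> nth false x k -> (mxpow H r *m u) (idx x) 0 = 0) ->
  forall (x : qb N) k, nth false x k -> u (idx x) 0 = 0.
Proof.
move=> hn hc hg g0 nN h.
(* The claim is made for all [r] at once, because clearing one more site for [H^r u] uses the
   cleared sites of [H^(r+1) u]. *)
suff S d r (x : qb N) k : (n - d <= k)%N -> nth false x k -> (mxpow H r *m u) (idx x) 0 = 0.
  by move=> x k xk; have := S n 0%N x k; rewrite subnn mul1mx => ->.
elim: d r x k => [|d IH] r x k; first by rewrite subn0; apply: h.
(* Truncated subtraction: once [d] reaches [n], both bounds are 0 and nothing new is claimed. *)
have [dn|dn] := leqP n d; first by rewrite (_ : n - d.+1 = n - d)%N ?[in RHS](_ : _ = 0%N) //; [apply: IH|lia].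
set m := (n - d.+1)%N; have md : (n - d = m.+1)%N by rewrite /m; lia.
rewrite md in IH; have mN : (m.+1 < N)%N by lia.
have [ex|noex] := boolP [exists k : 'I_N, (m < k)%N && nth false x k].
  by case/existsP: ex => k' /andP [mk' xk'] _ _; apply: IH mk' xk'.
have x0 k' : (m < k')%N -> nth false x k' = false.
  move=> mk'; have [kN|kN] := ltnP k' N; last by rewrite qb_over.
  by apply: contraNF noex => xk'; apply/existsP; exists (Ordinal kN); rewrite /= mk'.
move=> mk xk; have km : k = m.
  by apply/eqP; rewrite eqn_leq mk andbT leqNgt; apply/negP => /x0; rewrite xk.
rewrite {k mk}km in xk.
(* [x'] is [x] with its last excitation moved from [m] to [m.+1], where the induction hypothesis
   applies. *)
pose x' : qb N := [tuple (if val k == m then false else if val k == m.+1 then true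
                          else nth false x (val k)) | k < N].
have x'E k : (k < N)%N -> nth false x' k =
    if k == m then false else if k == m.+1 then true else nth false x k.
  exact: (nth_bits (fun k => if k == m then false else if k == m.+1 then true
                          else nth false x k)).
have x'1 : nth false x' m.+1 by rewrite x'E // gtn_eqF ?eqxx.
have x'0 : nth false x' m = false by rewrite x'E ?eqxx //; lia.
have x'far k : (m.+1 < k)%N -> nth false x' k = false.
  move=> mk; have [kN|kN] := ltnP k N; last by rewrite qb_over.
  by rewrite x'E // !gtn_eqF ?x0 //; lia.
have x'x : hop m x' x.
  split=> // [|k km km1]; first by apply: x0; apply: ltnSn.
  have [kN|kN] := ltnP k N; last by rewrite !qb_over.
  by rewrite x'E // (negbTE km) (negbTE km1).
(* Expand the vanishing amplitude of [H^(r+1) u] at [x']. Every [y] other than [x] that [H] connects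
   to [x'] has an excitation beyond [m], so only [g m] times the amplitude at [x] survives. *)
have := IH r.+1 x' m.+1 (leqnn _) x'1; rewrite mxpowS_mul mulmx_idxE (bigD1 x) //=.
rewrite big1 => [|y yx]; last first.
  have [->|Hxy] := eqVneq (H (idx x') (idx y)) 0; first by rewrite mul0r.
  suff [j mj yj] : exists2 j, (m < j)%N & nth false y j by rewrite (IH r y j) ?mulr0.
  have [<-|nxy] := eqVneq x' y; first by exists m.+1.
  have [i iN [[xi xi1 yi yi1 a]|[yi yi1 xi xi1 a]]] := nn_hop H x' y hn hc Hxy nxy.
    have [im|im] := eqVneq i m.
      case/eqP: yx; subst i; apply: qb_ext => k _.
      have [->|km] := eqVneq k m; first by rewrite yi xk.
      have [->|km1] := eqVneq k m.+1; first by rewrite yi1 x0.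
      by have [_ _ _ _ a'] := x'x; rewrite -a // a'.
    have [im1|im1] := eqVneq i m.+1; first by exists i => //; rewrite im1.
    by exists m.+1; rewrite // -a // ?eqSS eq_sym.
  have [im1|im1] := eqVneq i m.+1; first by exists i.+1 => //; rewrite im1 leqW.
  have [im|im] := eqVneq i m; first by rewrite -im xi1 in x'1.
  by exists m.+1; rewrite // a // ?eqSS eq_sym.
rewrite addr0 => /eqP; rewrite (hg m) // mulf_eq0 (negbTE (g0 m mN)) /=.
by move/eqP.
Qed.

(** * One protocol step seen on the chain *)

Notation vac n := [tuple false | _ < n].

Definition getB {n NB : nat} (x : qb (n + NB)) : qb NB :=
  [tuple nth false x (n + j) | j < NB].

Definition setB {n NB : nat} (x : qb (n + NB)) (b : qb NB) : qb (n + NB) :=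
  [tuple (if (n <= k)%N then nth false b (k - n) else nth false x k) | k < n + NB].

Lemma nth_getB {n NB} (x : qb (n + NB)) j : nth false (getB x) j = nth false x (n + j).
Proof.
have [h|h] := ltnP j NB; first exact: (nth_bits (fun j => nth false x (n + j))).
by rewrite !qb_over // leq_add2l.
Qed.

Lemma nth_setB {n NB} (x : qb (n + NB)) b k :
  nth false (setB x b) k = if (n <= k)%N then nth false b (k - n) else nth false x k.
Proof.
have [h|h] := ltnP k (n + NB).
  exact: (nth_bits (fun k => if (n <= k)%N then nth false b (k - n) else nth false x k)).
by rewrite !qb_over ?if_same //; lia.
Qed.

Lemma setBK {n NB} (x : qb (n + NB)) b : getB (setB x b) = b.
Proof.
by apply: qb_ext => k _; rewrite nth_getB nth_setB leq_addr addKn.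
Qed.

Lemma setB_set {n NB} (x : qb (n + NB)) b b' : setB (setB x b) b' = setB x b'.
Proof. by apply: qb_ext => k _; rewrite !nth_setB; case: (n <= k)%N. Qed.

Lemma setB_get {n NB} (x : qb (n + NB)) : setB x (getB x) = x.
Proof. by apply: qb_ext => k _; rewrite nth_setB; case: ifP => // nk; rewrite nth_getB subnKC. Qed.

(** Separates the content of B from the rest, the rest being represented with B empty; this merges a
    sum over Kraus outcomes into one over all configurations. *)
Lemma sum_setB {R : nmodType} {n NB} (F : qb (n + NB) -> R) :
  \sum_x F x = \sum_b \sum_(c | getB c == vac NB) F (setB c b).
Proof.
rewrite (partition_big getB xpredT) //=; apply: eq_bigr => b _.
rewrite (reindex_onto (fun c => setB c b) (fun x => setB x (vac NB))) => [|x /eqP <-].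
  apply: eq_bigl => c; rewrite setBK eqxx setB_set; apply/eqP/eqP => [<-|<-].
    exact: setBK.
  exact: setB_get.
by rewrite setB_set setB_get.
Qed.

(** Kraus operator of a step: evolve by [U], find [b] in B, and refill B with the vacuum from a
    fresh register. *)
Definition kraus {C : pzRingType} {n NB} (U : 'M[C]_#|qb (n + NB)|) (b : qb NB) :
    'M[C]_#|qb (n + NB)| :=
  mxof (fun c y => (getB c == vac NB)%:R * U (idx (setB c b)) (idx y)).

Lemma krausE {C : pzRingType} {n NB} (U : 'M[C]_#|qb (n + NB)|) b (v : 'cV_#|qb (n + NB)|) c :
  (kraus U b *m v) (idx c) 0 = (getB c == vac NB)%:R * (U *m v) (idx (setB c b)) 0.
Proof.
rewrite !mulmx_idxE mulr_sumr; apply: eq_bigr => y _.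
by rewrite mxofE mulrA.
Qed.

(* One protocol step in the Heisenberg picture; a chain observable is represented by its
   quadratic form [q], so that no operator algebra is needed. *)
Definition heis {C : pzRingType} {V : nmodType} {n NB} (U : 'M[C]_#|qb (n + NB)|)
    (q : 'cV[C]_#|qb (n + NB)| -> V) : 'cV[C]_#|qb (n + NB)| -> V :=
  fun v => \sum_b q (kraus U b *m v).

Lemma heis0 {C : pzRingType} {V : nmodType} {n NB} (U : 'M[C]_#|qb (n + NB)|)
    (q : 'cV[C]_#|qb (n + NB)| -> V) k : q 0 = 0 -> iter k (heis U) q 0 = 0.
Proof.
move=> q0; elim: k => //= k IH; rewrite /heis big1 // => b _.
by rewrite mulmx0.
Qed.

(** * Chain and memory together: the circuit [W] *)

(** The unnormalised chain state conditioned on memory content [m]; [chain_mean] sums a quadratic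
    form over these branches, giving its mean in the reduced chain state. *)
Definition slice {C : pzRingType} {T M : finType} (m : M) (w : 'cV[C]_#|{: T * M}|) :
    'cV[C]_#|T| :=
  \col_i w (idx (enum_val i, m)) 0.

Definition chain_mean {C : pzRingType} {V : nmodType} {T M : finType} (q : 'cV[C]_#|T| -> V)
    (w : 'cV[C]_#|{: T * M}|) : V :=
  \sum_m q (slice m w).

Lemma sliceE {C : pzRingType} {T M : finType} (m : M) (w : 'cV[C]_#|{: T * M}|) c :
  slice m w (idx c) 0 = w (idx (c, m)) 0.
Proof. by rewrite mxE idxK. Qed.

Definition memset {NB L : nat} (m : memT NB L) (l : 'I_L) (b : qb NB) : memT NB L :=
  [ffun l' => if l' == l then b else m l'].

Lemma sum_memset {R : nmodType} {NB L} (l : 'I_L) (F : memT NB L -> R) (z : qb NB) :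
  \sum_m F m = \sum_(m : memT NB L | m l == z) \sum_b F (memset m l b).
Proof.
rewrite (partition_big (fun m => memset m l z) (fun m => m l == z)) => [|m _]; last first.
  by rewrite ffunE eqxx.
apply: eq_bigr => m0 /eqP m0l.
rewrite (reindex_onto (memset m0 l) (fun m => m l)) => [|m /eqP <-].
  apply: eq_bigl => b; rewrite ffunE eqxx eqxx andbT; apply/eqP/ffunP => l'.
  by rewrite !ffunE; case: eqP => [->|].
by apply/ffunP => l'; rewrite !ffunE; case: eqP => [->|].
Qed.

Section evolution.
Context {R : realType} (NA NR NB L : nat) (H : 'M[R[i]]_#|qb (NA + NR + NB)|) (t : R).
Local Notation U := (propagator H t).
Local Notation sys := (sysT NA NR NB L).
Implicit Types (w : 'cV[R[i]]_#|sys|) (m : memT NB L).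

Lemma swapcfgE (l : 'I_L) c m :
  swapcfg l ((c, m) : sys) = (setB c (m l), memset m l (getB c)).
Proof. by []. Qed.

Lemma swapcfgK (l : 'I_L) : involutive (@swapcfg NA NR NB L l).
Proof.
move=> [c m]; rewrite !swapcfgE ffunE eqxx setB_set setB_get setBK; congr (_, _).
by apply/ffunP => l'; rewrite !ffunE; case: eqP => [->|].
Qed.

Lemma slice_step l w m c :
  (Sop NA NR NB L l *m Uop NA NR NB L H t *m w) (idx ((c, m) : sys)) 0 =
  (U *m slice (memset m l (getB c)) w) (idx (setB c (m l))) 0.
Proof.
rewrite -mulmxA mulmx_idxE (bigD1 (swapcfg l (c, m))) //= big1 => [|x nx]; last first.
  rewrite mxofE; case: eqP => [e|_]; last by rewrite mul0r.
  by rewrite e swapcfgK eqxx in nx.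
rewrite addr0 mxofE swapcfgK eqxx mul1r swapcfgE !mulmx_idxE.
transitivity (\sum_y \sum_m' Uop NA NR NB L H t (idx ((setB c (m l), memset m l (getB c)) : sys))
    (idx ((y, m') : sys)) * w (idx ((y, m') : sys)) 0).
  by rewrite pair_bigA; apply: eq_bigr => -[y m'].
apply: eq_bigr => y _; rewrite (bigD1 (memset m l (getB c))) //= big1 => [|m' nm].
  by rewrite mxofE eqxx mulr1 addr0 sliceE.
by rewrite mxofE /= eq_sym (negbTE nm) mulr0 mul0r.
Qed.

Definition blank l w := forall m, m l != vac NB -> slice m w = 0.

Lemma blank_step l l' w : l' != l -> blank l' w ->
  blank l' (Sop NA NR NB L l *m Uop NA NR NB L H t *m w).
Proof.
move=> ll hw m ml; apply/matrixP => i j; rewrite ord1; have [c ->] := idxP i.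
rewrite sliceE slice_step hw ?mulmx0 ?mxE //.
by rewrite ffunE (negbTE ll).
Qed.

(** With register [l] empty, the swap stores [b] there and empties B, so the new slices are the
    Kraus images of the old ones and the sum over the register becomes the sum over [b]. *)
Lemma chain_mean_step {V : nmodType} l w (q : 'cV[R[i]]_#|qb (NA + NR + NB)| -> V) :
  q 0 = 0 -> blank l w ->
  chain_mean q (Sop NA NR NB L l *m Uop NA NR NB L H t *m w) = chain_mean (heis U q) w.
Proof.
move=> q0 hw; rewrite /chain_mean (sum_memset l _ (vac NB)).
rewrite [RHS](bigID (fun m : memT NB L => m l == vac NB)) /= [RHS]addrC [X in _ = X + _]big1 ?add0r; last first.
  by move=> m ml; rewrite hw //; exact: (heis0 U q 1 q0).
apply: eq_bigr => m /eqP ml; apply: eq_bigr => b _; congr q.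
apply/matrixP => i j; rewrite ord1; have [c ->] := idxP i.
rewrite sliceE slice_step krausE ffunE eqxx.
have [cz|cz] := eqVneq (getB c) (vac NB).
  rewrite mul1r cz; congr ((_ *m slice _ _) _ _).
  by apply/ffunP => l'; rewrite !ffunE; case: eqP => [->|].
by rewrite mul0r hw ?mulmx0 ?mxE // ffunE eqxx.
Qed.

(** Each register is used once, hence is still blank at its turn. *)
Lemma chain_mean_Wop {V : nmodType} w (q : 'cV[R[i]]_#|qb (NA + NR + NB)| -> V) :
  q 0 = 0 -> (forall l, blank l w) ->
  chain_mean q (Wop NA NR NB L H t *m w) = chain_mean (iter L (heis U) q) w.
Proof.
move=> q0 hw; rewrite /Wop (_ : iter L _ _ = iter (size (enum 'I_L)) (heis U) q); last first.
  by rewrite size_enum_ord.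
have : uniq (enum 'I_L) := enum_uniq _.
have : forall l, l \in enum 'I_L -> blank l (1%:M *m w) by move=> l _; rewrite mul1mx.
(* The accumulator of [foldl] is generalised to an arbitrary [W] after which the remaining registers
   are blank. *)
rewrite -[w in RHS]mul1mx; move: 1%:M; elim: (enum 'I_L) => //= l ls IH W hW /andP [nl u].
rewrite IH //.
  by rewrite -[_ *m W *m w]mulmxA chain_mean_step ?heis0 //; apply: hW; rewrite inE eqxx.
move=> l' l'ls; rewrite -[_ *m W *m w]mulmxA; apply: blank_step; last by apply: hW; rewrite inE l'ls orbT.
by apply: contraNneq nl => <-.
Qed.

End evolution.

(** * The mean excitation number and its decay *)

Definition nhat {R : rcfType} {N : nat} (v : 'cV[R[i]]_#|qb N|) : R :=
  \sum_x (wt x)%:R * sqn (v (idx x) 0).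

Lemma nhat_ge0 {R : rcfType} {N} (v : 'cV[R[i]]_#|qb N|) : 0 <= nhat v.
Proof. by apply: sumr_ge0 => x _; rewrite mulr_ge0 ?sqn_ge0. Qed.

Lemma wt_le {N} (x : qb N) : (wt x <= N)%N.
Proof.
rewrite -[X in (_ <= X)%N]card_ord -sum1_card; apply: leq_sum => k _.
by case: (nth _ _ _).
Qed.

Lemma wt_eq0 {N} (x : qb N) : wt x = 0%N -> x = vac N.
Proof.
move=> w0; apply: qb_ext => k kN; rewrite nth_vac.
by move: w0; rewrite /wt (bigD1 (Ordinal kN)) //=; case: (nth _ _ _).
Qed.

Lemma wt_vac {N} : wt (vac N) = 0%N.
Proof. by rewrite /wt big1 // => k _; rewrite nth_vac. Qed.

Lemma wt_gt0 {N} (x : qb N) : (0 < wt x)%N -> exists k, nth false x k.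
Proof.
rewrite lt0n => h; have [k] : exists k : 'I_N, nth false x k.
  apply/existsP; apply: contraNT h; rewrite negb_exists => /forallP h.
  by rewrite /wt big1 // => k _; rewrite (negbTE (h k)).
by exists k.
Qed.

Lemma wt_setB_vac {n NB} (x : qb (n + NB)) :
  (wt (setB x (vac NB)) + (getB x != vac NB) <= wt x)%N.
Proof.
have le (k : 'I_(n + NB)) : (nth false (setB x (vac NB)) k <= nth false x k)%N.
  by rewrite nth_setB nth_vac; case: ifP.
have [_|ne] := eqVneq (getB x) (vac NB); first by rewrite addn0 leq_sum.
have [j] : exists j : 'I_NB, nth false (getB x) j.
  apply/existsP; apply: contraNT ne; rewrite negb_exists => /forallP h.
  by apply/eqP/qb_ext => k kN; rewrite nth_vac; apply/negbTE/(h (Ordinal kN)).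
rewrite nth_getB => xj; have jN : (n + j < n + NB)%N by rewrite ltn_add2l.
have e0 : nth false (setB x (vac NB)) (Ordinal jN) = 0%N :> nat.
  by rewrite nth_setB nth_vac leq_addr.
have e1 : nth false x (Ordinal jN) = 1%N :> nat by rewrite xj.
rewrite /wt (bigD1 (Ordinal jN)) // [X in (_ <= X)%N](bigD1 (Ordinal jN)) // e0 e1.
have shift (a b : nat) : (a <= b)%N -> (0 + a + 1 <= 1 + b)%N by lia.
by apply: shift; apply: leq_sum => k _.
Qed.

Lemma sqnv_idx {R : rcfType} {T : finType} (v : 'cV[R[i]]_#|T|) :
  sqnv v = \sum_x sqn (v (idx x) 0).
Proof. exact: sum_idx. Qed.

Lemma nhat_le {R : rcfType} {N} (v : 'cV[R[i]]_#|qb N|) : nhat v <= N%:R * sqnv v.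
Proof.
rewrite sqnv_idx mulr_sumr; apply: ler_sum => x _.
by rewrite ler_wpM2r ?sqn_ge0 // ler_nat wt_le.
Qed.

(** Every configuration other than the vacuum has weight at least 1. *)
Lemma vac_ge {R : rcfType} {N} (v : 'cV[R[i]]_#|qb N|) :
  sqnv v - nhat v <= sqn (v (idx (vac N)) 0).
Proof.
rewrite sqnv_idx -sumrB (bigD1 (vac N)) // wt_vac mul0r subr0 gerDl.
apply: sumr_le0 => x nx; rewrite subr_le0 ler_peMl ?sqn_ge0 // ler1n lt0n.
by apply: contraNneq nx => /wt_eq0 ->.
Qed.

Lemma mxpowSr {C : pzRingType} {n} (A : 'M[C]_n) k : mxpow A k.+1 = mxpow A k *m A.
Proof.
elim: k => [|k IH]; first by rewrite /= mul1mx mulmx1.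
by rewrite -[LHS]/(A *m mxpow A k.+1) [in LHS]IH mulmxA.
Qed.

Section decay.
Context {R : realType} {n NB : nat} (U : 'M[R[i]]_#|qb (n + NB)|).
Local Notation N := (n + NB)%N.
Hypothesis unitaryU : adj U *m U = 1%:M.
Hypothesis wtU : forall x y : qb N, U (idx x) (idx y) != 0 -> wt x = wt y.
Implicit Types v : 'cV[R[i]]_#|qb N|.

(** A diagonal observable after a step is read after [U] on the configuration with B emptied. *)
Lemma heis_weighted (c : qb N -> R) v :
  heis U (fun u => \sum_x c x * sqn (u (idx x) 0)) v =
  \sum_x c (setB x (vac NB)) * sqn ((U *m v) (idx x) 0).
Proof.
rewrite [RHS]sum_setB; apply: eq_bigr => b _.
rewrite (bigID (fun x => getB x == vac NB)) /= [X in _ + X]big1 ?addr0 => [|x nx].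
  apply: eq_bigr => x zx; rewrite krausE zx mul1r setB_set.
  by rewrite -[in LHS](setB_get x) (eqP zx) setB_set.
by rewrite krausE (negbTE nx) mul0r sqn0 mulr0.
Qed.

Lemma heis_sqnv v : heis U sqnv v = sqnv v.
Proof.
rewrite -[RHS](sqnv_isometry _ _ unitaryU) [RHS]sqnv_idx.
under [RHS]eq_bigr do rewrite -[sqn _]mul1r.
rewrite -(heis_weighted (fun=> 1)); apply: eq_bigr => b _.
by rewrite sqnv_idx; apply: eq_bigr => x _; rewrite mul1r.
Qed.

Lemma iter_heis_sqnv k v : iter k (heis U) sqnv v = sqnv v.
Proof.
elim: k v => //= k IH v; rewrite -[RHS]heis_sqnv.
by apply: eq_bigr => b _; rewrite IH.
Qed.

(** Writes [nhat] as a squared norm, the form needed by [sqnv_isometry] and [ker_sub_bound]. *)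
Definition sqrt_nhat : 'M[R[i]]_#|qb N| :=
  diag_mx (\row_i (Num.sqrt (wt (enum_val i : qb N))%:R)%:C).

Lemma sqrt_nhatE v x :
  (sqrt_nhat *m v) (idx x) 0 = (Num.sqrt (wt x)%:R)%:C * v (idx x) 0.
Proof. by rewrite mul_diag_mx !mxE idxK. Qed.

Lemma nhat_sqnv v : nhat v = sqnv (sqrt_nhat *m v).
Proof.
rewrite sqnv_idx; apply: eq_bigr => x _.
by rewrite sqrt_nhatE sqnM sqn_real sqr_sqrtr.
Qed.

Lemma nhat_invariant v : nhat (U *m v) = nhat v.
Proof.
rewrite !nhat_sqnv -[RHS](sqnv_isometry _ _ unitaryU) !mulmxA; congr (sqnv (_ *m _)).
apply/matrixP => i j; have [x ->] := idxP i; have [y ->] := idxP j.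
rewrite mul_diag_mx mul_mx_diag !mxE !idxK mulrC.
have [->|/wtU ->//] := eqVneq (U (idx x) (idx y)) 0.
by rewrite !mul0r.
Qed.

Definition absorbed v : R :=
  \sum_(x | getB x != vac NB) sqn ((U *m v) (idx x) 0).

Lemma absorbed_ge0 v : 0 <= absorbed v.
Proof. by apply: sumr_ge0 => x _; apply: sqn_ge0. Qed.

(** [U] preserves the number, and emptying B removes at least one excitation wherever B is not
    empty. *)
Lemma heis_nhat v : heis U nhat v <= nhat v - absorbed v.
Proof.
rewrite [heis _ _ _](heis_weighted (fun x => (wt x)%:R)) -nhat_invariant lerBrDr.
rewrite /absorbed [X in _ + X]big_mkcond -big_split; apply: ler_sum => x _ /=.
have := wt_setB_vac x; rewrite -(ler_nat R) natrD => h.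
apply: le_trans (ler_wpM2r (sqn_ge0 _) h); rewrite mulrDl lerD2l.
by case: ifP; rewrite ?mul1r ?mul0r.
Qed.

Local Notation K0 := (kraus U (vac NB)).

(** Only the branch in which B was always found empty is followed; the absorption in the other
    branches is nonnegative and is dropped. *)
Lemma iter_heis_nhat k v :
  iter k (heis U) nhat v <= nhat v - \sum_(j < k) absorbed (mxpow K0 j *m v).
Proof.
elim: k v => [|k IH] v; first by rewrite big_ord0 subr0.
rewrite iterS /heis; apply: le_trans (ler_sum _ (fun b _ => IH _)) _.
rewrite sumrB -/(heis U nhat v); apply: le_trans (lerB (heis_nhat v) (lexx _)) _.
rewrite -addrA lerD2l -opprD lerN2 big_ord_recl mul1mx lerD2l.
rewrite (bigD1 (vac NB)) //= ler_wpDr //.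
  by apply: sumr_ge0 => b _; apply: sumr_ge0 => j _; apply: absorbed_ge0.
apply: ler_sum => j _; rewrite -[X in absorbed X <= _]/(mxpow K0 j.+1 *m v).
by rewrite mxpowSr mulmxA.
Qed.

(** Without absorption [U] already leaves B empty, so projecting on empty B changes nothing. *)
Lemma unabsorbed v d : (forall j, (j < d)%N -> absorbed (mxpow K0 j *m v) = 0) ->
  forall j, (j <= d)%N -> mxpow K0 j *m v = mxpow U j *m v.
Proof.
move=> h; elim=> [//|j IH jd]; rewrite !mxpowS_mul -IH ?(ltnW jd) //.
apply/matrixP => i k; rewrite ord1; have [x ->] := idxP i.
rewrite krausE; have [zx|nzx] := eqVneq (getB x) (vac NB).
  by rewrite mul1r -{2}(setB_get x) zx.
rewrite mul0r; move/eqP: (h j jd); rewrite psumr_eq0 => [/allP /(_ x)|y _]; last exact: sqn_ge0.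
by rewrite mem_index_enum nzx => /(_ isT) /eqP /sqn_eq0 ->.
Qed.

Variable d : nat.
(** The powers start at 1 because B is emptied only after an application of [U]. *)
Hypothesis dark : forall v,
  (forall j (x : qb N), (0 < j <= d)%N -> getB x != vac NB -> (mxpow U j *m v) (idx x) 0 = 0) ->
  forall x, (0 < wt x)%N -> v (idx x) 0 = 0.

(** A state with zero total absorption is dark, hence killed by [sqrt_nhat]; [ker_sub_bound] makes
    this implication quantitative. *)
Lemma absorption_gap :
  exists2 del : R, 0 < del & forall v, del * nhat v <= \sum_(j < d) absorbed (mxpow K0 j *m v).
Proof.
(* [A] stacks the amplitudes absorbed at all [d] steps, so that its squared norm is the total
   absorption. *)
pose A : 'M[R[i]]_(#|{: 'I_d * qb N}|, #|qb N|) := \matrix_(i, k)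
  let p : 'I_d * qb N := enum_val i in
  (getB p.2 != vac NB)%:R * (U *m mxpow K0 p.1) (idx p.2) k.
have AE v j x : (A *m v) (idx (j, x)) 0 =
    (getB x != vac NB)%:R * (U *m mxpow K0 j *m v) (idx x) 0.
  rewrite mxE [in RHS]mxE mulr_sumr; apply: eq_bigr => k _.
  by rewrite [A _ _]mxE idxK mulrA.
have nA v : sqnv (A *m v) = \sum_(j < d) absorbed (mxpow K0 j *m v).
  rewrite sqnv_idx (eq_bigr (fun p : 'I_d * qb N =>
    (getB p.2 != vac NB)%:R * sqn ((U *m mxpow K0 p.1 *m v) (idx p.2) 0))) => [|[j x] _].
    rewrite -(pair_bigA _ (fun (j : 'I_d) (x : qb N) => (getB x != vac NB)%:R *
      sqn ((U *m mxpow K0 j *m v) (idx x) 0))) /=; apply: eq_bigr => j _.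
    rewrite /absorbed [RHS]big_mkcond; apply: eq_bigr => x _; rewrite mulmxA.
    by case: eqP; rewrite ?mul1r ?mul0r.
  by rewrite AE; case: eqP; rewrite ?mul1r ?mul0r ?sqn0.
have [|del del0 hdel] := @ker_sub_bound R _ _ _ A sqrt_nhat.
  move=> v Av; apply/matrixP => i k; rewrite ord1 [in RHS]mxE; have [x ->] := idxP i.
  rewrite sqrt_nhatE; have [->|wx] := posnP (wt x); first by rewrite sqrtr0 mul0r.
  rewrite dark ?mulr0 // => j y /andP [j0 jd] ny.
  have abs0 j' : (j' < d)%N -> absorbed (mxpow K0 j' *m v) = 0.
    move=> j'd; apply/eqP; have : sqnv (A *m v) = 0.
      by rewrite Av /sqnv big1 // => ? _; rewrite mxE sqn0.
    rewrite nA => /eqP; rewrite psumr_eq0 => [/allP|? _]; last exact: absorbed_ge0.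
    by move=> /(_ (Ordinal j'd)); rewrite mem_index_enum => /(_ isT).
  rewrite -(unabsorbed v d abs0 j jd) -(prednK j0) mxpowS_mul krausE.
  by rewrite (negbTE ny) mul0r.
by exists del => // v; rewrite nhat_sqnv -nA.
Qed.

Lemma heis_contraction : exists c : R, [/\ 0 <= c, c < 1 &
  forall v, iter d (heis U) nhat v <= c * nhat v].
Proof.
have [del del0 h] := absorption_gap.
have [dl|dl] := lerP del 1.
  exists (1 - del); split; rewrite ?subr_ge0 // ?ltrBlDr ?ltrDl // => v.
  by apply: le_trans (iter_heis_nhat d v) _; rewrite mulrBl mul1r lerB.
exists 0; split=> // v; rewrite mul0r.
apply: le_trans (iter_heis_nhat d v) _; rewrite subr_le0.
by apply: le_trans (h v); rewrite ler_peMl ?nhat_ge0 // ltW.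
Qed.

Lemma iter_heis_le k (q q' : 'cV[R[i]]_#|qb N| -> R) c :
  (forall v, q v <= c * q' v) -> forall v, iter k (heis U) q v <= c * iter k (heis U) q' v.
Proof.
move=> h; elim: k => //= k IH v; rewrite mulr_sumr.
exact: ler_sum.
Qed.

Lemma heis_nhat_decay (eta : R) : 0 < eta ->
  exists2 L, (0 < L)%N & forall v, iter L (heis U) nhat v <= eta * sqnv v.
Proof.
move=> eta0; have [c [c0 c1 h]] := heis_contraction.
have geo k v : iter (k * d) (heis U) nhat v <= c ^+ k * nhat v.
  elim: k v => [|k IH] v; first by rewrite mul1r.
  rewrite mulSn [(d + _)%N]addnC iterD exprS.
  apply: le_trans (iter_heis_le _ _ _ _ h _) _.
  by rewrite -mulrA ler_wpM2l.
have N1 : 0 < N%:R + 1 :> R by rewrite ltr_wpDl.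
(* The factor [N] lost in [nhat_le] is compensated here; adding 1 keeps the denominator positive. *)
have [k hk] : exists k, c ^+ k <= eta / (N%:R + 1).
  have /cvgrPdist_le /(_ (eta / (N%:R + 1))) : ((c ^+ k) @[k --> \oo] --> 0)%classic.
    by apply: cvg_expr; rewrite ger0_norm.
  case=> [|k _ hk]; first by rewrite divr_gt0.
  exists k; have := hk k (leqnn k).
  by rewrite /= sub0r normrN ger0_norm // exprn_ge0.
(* The extra step makes [L] positive and costs nothing, since [heis] preserves [sqnv]. *)
exists (k * d).+1 => // v; rewrite iterS.
rewrite -[sqnv v]heis_sqnv mulr_sumr; apply: ler_sum => b _.
apply: le_trans (geo k _) _; apply: le_trans (ler_wpM2l (exprn_ge0 _ c0) (nhat_le _)) _.
rewrite mulrA ler_wpM2r ?sqnv_ge0 //.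
apply: le_trans (ler_wpM2r _ hk) _ => //.
by rewrite -mulrA ler_piMr ?(ltW eta0) // mulrC ler_pdivrMr // mul1r lerDl.
Qed.

End decay.

(** * Dark states of the propagator *)

Lemma mxpow_wt {R : rcfType} {N : nat} (H : 'M[R[i]]_#|qb N|) r (x y : qb N) :
  conserves_excitations H -> mxpow H r (idx x) (idx y) != 0 -> wt x = wt y.
Proof.
move=> hc; elim: r x => [|r IH] x.
  by rewrite mxE (inj_eq idx_inj); have [->|] := eqVneq x y; rewrite ?eqxx.
rewrite [mxpow _ _]/= -/(mxpow _ _) mulmx_idxE => h.
have [z] : exists z : qb N, H (idx x) (idx z) * mxpow H r (idx z) (idx y) != 0.
  apply/existsP; apply: contraNT h; rewrite negb_exists => /forallP h.
  by rewrite big1 // => z _; apply/eqP; move: (h z); rewrite negbK.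
by rewrite mulf_eq0 negb_or => /andP [/(conserves_wt _ _ _ hc) -> /IH].
Qed.

Lemma propagator_wt {R : realType} {N : nat} (H : 'M[R[i]]_#|qb N|) t (x y : qb N) :
  conserves_excitations H -> propagator H t (idx x) (idx y) != 0 -> wt x = wt y.
Proof.
move=> hc; apply: contra_neq_eq => wxy; apply: expm_entry0 => r.
rewrite mxpowZ mxE; have [->|/(mxpow_wt _ _ _ _ hc) //] := eqVneq (mxpow H r (idx x) (idx y)) 0.
  by rewrite mulr0.
by move/eqP: wxy.
Qed.

Lemma row_entry {C : pzRingType} {T : finType} {p} (x : T) (A : 'M[C]_(#|T|, p)) j :
  (delta_mx 0 (idx x) *m A) (0 : 'I_1) j = A (idx x) j.
Proof. by rewrite -rowE mxE. Qed.

(** Passing to [u = U v] turns the powers 1 to dim on [v] into 0 to dim - 1 on [u], the range from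
    which all [H^r u] are reached. [dark_vacuum], with [n] the first site of B, leaves only the
    vacuum in [u], and [v = U^dag u] inherits this by weight conservation. *)
Lemma dark_states_trivial {R : realType} {n NB : nat} (H : 'M[R[i]]_#|qb (n + NB)|)
    (g : nat -> R[i]) (t : R) (v : 'cV_#|qb (n + NB)|) :
  (0 < NB)%N -> nn_hamiltonian H -> conserves_excitations H ->
  (forall j (x y : qb (n + NB)), (j.+1 < n + NB)%N -> hop j x y -> H (idx x) (idx y) = g j) ->
  (forall j, (j.+1 < n + NB)%N -> g j != 0) ->
  adj (propagator H t) *m propagator H t = 1%:M ->
  (forall (phi : 'rV_#|qb (n + NB)|) (u : 'cV_#|qb (n + NB)|),
     (forall i, (i < #|qb (n + NB)|)%N -> phi *m mxpow (propagator H t) i *m u = 0) ->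
     forall r, phi *m mxpow H r *m u = 0) ->
  (forall j (x : qb (n + NB)), (0 < j <= #|qb (n + NB)|)%N -> getB x != vac NB ->
     (mxpow (propagator H t) j *m v) (idx x) 0 = 0) ->
  forall x, (0 < wt x)%N -> v (idx x) 0 = 0.
Proof.
move=> NB0 hn hc hg g0 unitU span hv.
set U := propagator H t in unitU span hv; pose u := U *m v.
have u0 (x : qb (n + NB)) k : nth false x k -> u (idx x) 0 = 0.
  apply: (dark_vacuum H g u n hn hc hg g0); first by rewrite -[X in (X < _)%N]addn0 ltn_add2l.
  move=> r {}x {}k nk xk; rewrite -row_entry mulmxA span ?mxE // => i iN.
  rewrite /u mulmxA -[_ *m mxpow U i *m U]mulmxA -mxpowSr -mulmxA.
  apply/matrixP => a b; rewrite !ord1 row_entry [RHS]mxE hv //.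
  apply: contraTneq xk => /(congr1 (fun b : qb NB => nth false b (k - n))).
  by rewrite nth_getB nth_vac subnKC // => ->.
move=> x wx; have -> : v = adj U *m u by rewrite /u mulmxA unitU mul1mx.
rewrite mulmx_idxE big1 // => y _; have [wy|/wt_gt0 [k /u0 ->]] := posnP (wt y); last exact: mulr0.
rewrite adjE; have [->|/(propagator_wt _ _ _ _ hc) e] := eqVneq (U (idx y) (idx x)) 0.
  by rewrite conjc0 mul0r.
by rewrite -e wy in wx.
Qed.

(** * Preparation, vacuum projection and fidelity *)

Section encoding.
Context {R : realType} (NA NR NB L : nat).
Local Notation sys := (sysT NA NR NB L).
Local Notation mem0 := ([ffun=> vac NB] : memT NB L).

Definition prefixA (x : qb (NA + NR + NB)) : qb NA := [tuple nth false x k | k < NA].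

(** The preparation as a matrix, so that the protocol becomes one linear map on A. *)
Definition init_mx : 'M[R[i]]_(#|sys|, #|qb NA|) :=
  \matrix_(i, j) let x : sys := enum_val i in
    (idx (prefixA x.1) == j)%:R *
    ([forall k : 'I_(NA + NR + NB), (NA <= k)%N ==> ~~ nth false x.1 k] && (x.2 == mem0))%:R.

Lemma init_stateE psi : init_state NA NR NB L psi = init_mx *m psi.
Proof.
apply/matrixP => i k; rewrite ord1 !mxE (bigD1 (idx (prefixA (enum_val i : sys).1))) //=.
rewrite mxE /= eqxx mul1r mulrC big1 ?addr0 // => j nj.
by rewrite mxE /= eq_sym (negbTE nj) !mul0r.
Qed.

Lemma nth_prefixA x k : (k < NA)%N -> nth false (prefixA x) k = nth false x k.
Proof. exact: (nth_bits (fun k => nth false x k)). Qed.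

Lemma slice_init (psi : 'cV[R[i]]_#|qb NA|) m x :
  slice m (init_state NA NR NB L psi) (idx x) 0 = psi (idx (prefixA x)) 0 *
  ([forall k : 'I_(NA + NR + NB), (NA <= k)%N ==> ~~ nth false x k] && (m == mem0))%:R.
Proof. by rewrite sliceE mxE idxK. Qed.

Lemma blank_init (psi : 'cV[R[i]]_#|qb NA|) l :
  blank NA NR NB L l (init_state NA NR NB L psi).
Proof.
move=> m ml; apply/matrixP => i j; rewrite ord1; have [x ->] := idxP i.
rewrite slice_init [RHS]mxE (_ : (m == mem0) = false) ?andbF ?mulr0 //.
by apply: contraNF ml => /eqP ->; rewrite ffunE.
Qed.

Lemma chain_mean_init {V : nmodType} (q : 'cV[R[i]]_#|qb (NA + NR + NB)| -> V) psi :
  q 0 = 0 -> chain_mean q (init_state NA NR NB L psi) =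
    q (slice mem0 (init_state NA NR NB L psi)).
Proof.
move=> q0; rewrite /chain_mean (bigD1 mem0) //= big1 ?addr0 // => m nm.
rewrite (_ : slice m _ = 0) //; apply/matrixP => i j; rewrite ord1; have [x ->] := idxP i.
by rewrite slice_init (negbTE nm) andbF mulr0 mxE.
Qed.

Lemma sqnv_slice_init (psi : 'cV[R[i]]_#|qb NA|) :
  sqnv (slice mem0 (init_state NA NR NB L psi)) = sqnv psi.
Proof.
pose emp (x : qb (NA + NR + NB)) := [forall k : 'I_(NA + NR + NB), (NA <= k)%N ==> ~~ nth false x k].
have empP x : emp x -> forall k, (NA <= k)%N -> nth false x k = false.
  move=> /forallP h k NAk; have [kN|kN] := ltnP k (NA + NR + NB); last by rewrite qb_over.
  by apply/negbTE; have := h (Ordinal kN); rewrite /= NAk.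
pose ext (a : qb NA) : qb (NA + NR + NB) := [tuple nth false a k | k < NA + NR + NB].
have nth_ext a k : nth false (ext a) k = nth false a k.
  have [kN|kN] := ltnP k (NA + NR + NB); first exact: (nth_bits (fun k => nth false a k)).
  by rewrite !qb_over //; lia.
rewrite !sqnv_idx (bigID emp) /= [X in _ + X]big1 ?addr0 => [|x /negbTE nx]; last first.
  by rewrite slice_init -/(emp x) nx mulr0 sqn0.
rewrite (reindex_onto ext prefixA) => [|x hx].
  apply: eq_big => [a|a /andP [ha _]].
    apply/andP; split; last by apply/eqP/qb_ext => k kNA; rewrite nth_prefixA // nth_ext.
    by apply/forallP => k; apply/implyP => NAk; rewrite nth_ext qb_over.
  rewrite slice_init -/(emp _) ha eqxx mulr1; congr (sqn (psi (idx _) 0)).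
  by apply: qb_ext => k kNA; rewrite nth_prefixA // nth_ext.
apply: qb_ext => k kN; rewrite nth_ext; have [NAk|kNA] := leqP NA k.
  by rewrite qb_over // (empP x).
by rewrite nth_prefixA.
Qed.

(** The bipartite state reshaped as a matrix from chain to memory; the reduced memory state is
    [amp w] times its adjoint. *)
Definition amp (w : 'cV[R[i]]_#|sys|) : 'M[R[i]]_(#|memT NB L|, #|qb (NA + NR + NB)|) :=
  \matrix_(i, j) w (idx ((enum_val j, enum_val i) : sys)) 0.

Lemma ptrace_amp (w : 'cV[R[i]]_#|sys|) :
  ptrace_chain NA NR NB L (w *m adj w) = amp w *m adj (amp w).
Proof.
apply/matrixP => i j; rewrite mxE [RHS]mxE sum_idx; apply: eq_bigr => c _.
by rewrite mxE big_ord1 !adjE !mxE idxK.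
Qed.

(** The bra of the chain vacuum tensored with the identity on the memory. *)
Definition vac_mx : 'M[R[i]]_(#|memT NB L|, #|sys|) :=
  \matrix_(i, k) (k == idx ((vac (NA + NR + NB), enum_val i) : sys))%:R.

Lemma vac_mxE (w : 'cV[R[i]]_#|sys|) m :
  (vac_mx *m w) (idx m) 0 = w (idx ((vac (NA + NR + NB), m) : sys)) 0.
Proof.
rewrite mxE (bigD1 (idx ((vac (NA + NR + NB), m) : sys))) //= big1 => [|k nk].
  by rewrite mxE idxK eqxx mul1r addr0.
by rewrite mxE idxK (negbTE nk) mul0r.
Qed.

(** The fidelity is a sum of squared overlaps over chain configurations, of which only the vacuum
    term is kept. *)
Lemma fidelity_ge (w : 'cV[R[i]]_#|sys|) (y : 'cV[R[i]]_#|memT NB L|) :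
  exists2 a : R, (adj y *m ptrace_chain NA NR NB L (w *m adj w) *m y) 0 0 = a%:C &
    sqn ((adj y *m (vac_mx *m w)) 0 0) <= a.
Proof.
exists (sqnv (adj (amp w) *m y)).
  by rewrite ptrace_amp -sqnvE adjM adjK !mulmxA.
rewrite sqnv_idx (bigD1 (vac _)) //= ler_wpDr //.
  by apply: sumr_ge0 => c _; apply: sqn_ge0.
have -> : (adj (amp w) *m y) (idx (vac (NA + NR + NB))) 0 =
    conjc ((adj y *m (vac_mx *m w)) 0 0).
  rewrite mxE [X in conjc X]mxE rmorph_sum; apply: eq_bigr => i _.
  have [m ->] := idxP i.
  by rewrite rmorphM vac_mxE !adjE /= conjcK mulrC mxE !idxK.
by rewrite /sqn; case: (X in conjc X) => a b /=; rewrite sqrrN.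
Qed.

End encoding.

(** * Assembly of the bound *)

(** One time [t] serves all [eta]; only the number of registers depends on the precision. *)
Lemma vacuum_amplitude {R : realType} (NA NR NB : nat) (H : 'M[R[i]]_#|qb (NA + NR + NB)|) :
  (0 < NB)%N -> is_hermitian H -> nn_hamiltonian H -> conserves_excitations H ->
  (exists t0 : R, f1N H t0 != 0) -> exists2 t : R, 0 < t &
  forall eta : R, 0 < eta -> exists2 L, (0 < L)%N & forall psi : 'cV_#|qb NA|,
    (1 - eta) * sqnv psi <=
    sqnv (vac_mx NA NR NB L *m (Wop NA NR NB L H t *m init_state NA NR NB L psi)).
Proof.
move=> NB0 hH hn hc [t0 hf].
have [g hg] := hop_entry H hn.
have g0 := hopping_neq0 H g t0 hn hc hg hf.
have [t [t_gt0 unitU span]] := good_time H hH.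
exists t => // eta eta0.
have [L L0 hL] := heis_nhat_decay (propagator H t) unitU
  (fun x y => propagator_wt H t x y hc) _
  (fun v => dark_states_trivial H g t v NB0 hn hc hg g0 unitU span) eta eta0.
exists L => // psi; set w := Wop _ _ _ _ _ _ *m _.
have mean (q : 'cV[R[i]]_#|qb (NA + NR + NB)| -> R) : q 0 = 0 -> chain_mean q w =
    iter L (heis (propagator H t)) q (slice [ffun=> vac NB] (init_state NA NR NB L psi)).
  move=> q0; rewrite chain_mean_Wop // => [|l]; last exact: blank_init.
  by rewrite chain_mean_init // heis0.
have sqnv0 k : sqnv (0 : 'cV[R[i]]_k) = 0.
  by rewrite /sqnv big1 // => i _; rewrite mxE sqn0.
have nhat0 : nhat (0 : 'cV[R[i]]_#|qb (NA + NR + NB)|) = 0.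
  by rewrite /nhat big1 // => x _; rewrite mxE sqn0 mulr0.
have := mean sqnv (sqnv0 _); have := mean nhat nhat0.
rewrite (iter_heis_sqnv _ unitU) sqnv_slice_init => meanN meanS.
apply: le_trans (_ : chain_mean sqnv w - chain_mean nhat w <= _).
  rewrite meanS meanN mulrBl mul1r lerB //.
  by have := hL (slice [ffun=> vac NB] (init_state NA NR NB L psi)); rewrite sqnv_slice_init.
rewrite /chain_mean -sumrB sqnv_idx; apply: ler_sum => m _.
by rewrite vac_mxE -sliceE vac_ge.
Qed.

Theorem mainTheorem1 (R : realType) (NA NR NB : nat)
  (hNA : (1 <= NA)%N) (hNB : (1 <= NB)%N)
  (H : 'M[R[i]]_#|qb (NA + NR + NB)|)
  (hH : is_hermitian H)
  (hloc : nn_hamiltonian H)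
  (hcons : conserves_excitations H)
  (hf : exists t0 : R, f1N H t0 != 0) :
  forall eps : R, 0 < eps ->
  exists (t : R) (L : nat), 0 < t /\ (1 <= L)%N /\
    exists E : 'M[R[i]]_(#|memT NB L|, #|qb NA|), is_isometry E /\
      forall psi : 'cV[R[i]]_#|qb NA|, adj psi *m psi = 1%:M ->
        (1 - eps%:C) <=
          (adj psi *m adj E *m rhoM NA NR NB L H t psi *m E *m psi) ord0 ord0.
Proof.
move=> eps eps0.
have [t t0 ht] := vacuum_amplitude NA NR NB H hNB hH hloc hcons hf.
(* The cap 1/2 keeps [1 - eta] positive, so that its square root is a valid bound for
   [polar_isometry]. *)
pose eta := Num.min eps 2^-1.
have eta0 : 0 < eta by rewrite lt_min eps0 invr_gt0 ltr0n.
have eta1 : 0 < 1 - eta.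
  have : eta <= 2^-1 by rewrite ge_min lexx orbT.
  by move=> h; rewrite subr_gt0 (le_lt_trans h) // invf_lt1 ?ltr0n // ltr1n.
have [L L0 hL] := ht eta eta0.
exists t, L; split=> //; split=> //.
pose F := vac_mx NA NR NB L *m (Wop NA NR NB L H t *m init_mx NA NR NB L).
have FE psi : F *m psi = vac_mx NA NR NB L *m (Wop NA NR NB L H t *m init_state NA NR NB L psi).
  by rewrite /F init_stateE !mulmxA.
have [||E isoE hE] := polar_isometry F (Num.sqrt (1 - eta)).
- by rewrite sqrtr_gt0.
- by move=> psi; rewrite sqr_sqrtr ?(ltW eta1) // FE hL.
exists E; split=> // psi psi1.
have npsi : sqnv psi = 1.
  by apply: (@complexI R); rewrite -sqnvE psi1 mxE eqxx.
rewrite /rhoM; set w := Wop NA NR NB L H t *m init_state NA NR NB L psi.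
rewrite (_ : _ *m (_ *m _) *m _ = w *m adj w); last by rewrite adjM !mulmxA.
have [a aE ha] := fidelity_ge NA NR NB L w (E *m psi).
rewrite -adjM -[_ *m E *m psi]mulmxA aE.
(* [r] is the overlap of [E psi] with [F psi], at least the square root of [1 - eta]; its square
   bounds the fidelity from below. *)
have [r hr rE] := hE psi; move: ha hr.
rewrite -FE adjM !mulmxA; move: rE; rewrite !mulmxA => ->.
rewrite npsi mulr1 sqn_real => ha hr.
rewrite -[1 : R[i]]/(1%:C) -rmorphB lecR; apply: le_trans ha.
apply: (@le_trans _ _ (1 - eta)); first by rewrite lerD2l lerN2 ge_min lexx.
rewrite -[1 - eta]sqr_sqrtr ?(ltW eta1) //.
by rewrite lerXn2r // nnegrE ?sqrtr_ge0 // (le_trans _ hr) // sqrtr_ge0.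
Qed.
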